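(* Let $\mu$ be a finitely supported, symmetric probability measure on $\mathrm{Homeo}^+(\mathbf{R})$ whose support generates an irreducible group $G$ without discrete orbits. Then $G$ is semi-conjugate to a group $\bar G\subset\mathrm{Homeo}^+(\mathbf{R})$ such that the pair $(\bar G,\mu)$ has the Derriennic property.
   Context: $\mathrm{Homeo}^+(\mathbf{R})$ is the group of orientation-preserving (increasing) homeomorphisms of the real line. A measure $\mu$ is symmetric if $\mu(g)=\mu(g^{-1})$ for all $g$. A group $G\subset\mathrm{Homeo}^+(\mathbf{R})$ is irreducible if it has no global fixed point in $\mathbf{R}$. A discrete orbit is a $G$-orbit that is a closed discrete subset of $\mathbf{R}$. The action of $G\subset\mathrm{Homeo}^+(\mathbf{R})$ is semi-conjugate to that of a homomorphic image $\bar G\subset\mathrm{Homeo}^+(\mathbf{R})$ (with $g\mapsto\bar g$ the homomorphism $G\to\bar G$) if there is a surjective, nondecreasing, continuous map $D:\mathbf{R}\to\mathbf{R}$ such that $D(g(x))=\bar g(D(x))$ for all $x\in\mathbf{R}$ and all $g\in G$. For a symmetric probability measure $\mu$ with finite support generating an irreducible group $G$, the pair $(G,\mu)$ has the Derriennic property if $x=\int_G g(x)\,d\mu(g)$ for every $x\in\mathbf{R}$. In the pair $(\bar G,\mu)$, $\mu$ stands for the image of $\mu$ under $g\mapsto\bar g$; thus the property reads $\sum_g\mu(g)\,\bar g(x)=x$ for every $x\in\mathbf{R}$. *)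

(* Defs.v *)
From HB Require Import structures.
From mathcomp Require Import all_boot all_order all_algebra.
From mathcomp Require Import all_classical all_reals all_analysis.
Set Implicit Arguments.
Unset Strict Implicit.
Unset Printing Implicit Defensive.
Import Order.TTheory GRing.Theory Num.Theory.
Import numFieldNormedType.Exports.
Local Open Scope classical_set_scope.
Local Open Scope ring_scope.

Definition increasing_homeo (R : realType) (f : R -> R) : Prop :=
  [/\ {homo f : x y / x < y}, continuous f &
      exists2 h : R -> R, continuous h & cancel f h /\ cancel h f].

Record homeo (R : realType) := Homeo {
  homeo_fun :> R -> R ;
  homeo_subproof : `[< increasing_homeo homeo_fun >] }.

HB.instance Definition _ (R : realType) := [isSub of homeo R for @homeo_fun R].
HB.instance Definition _ (R : realType) := [Choice of homeo R by <:].

Section HomeoGroup.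
Variable R : realType.
Implicit Types f g h : homeo R.

Lemma homeoP f : increasing_homeo f.
Proof. exact/asboolP/homeo_subproof. Qed.

Lemma homeo_ext f g : f =1 g -> f = g.
Proof. by move=> fg; apply/val_inj/funext. Qed.

Lemma increasing_homeo_id : increasing_homeo (@idfun R).
Proof.
split=> //; first by move=> x; exact: cvg_id.
by exists idfun => // x; exact: cvg_id.
Qed.

Lemma increasing_homeo_comp f g : increasing_homeo (f \o g).
Proof.
have [fi fc [f' f'c [fK f'K]]] := homeoP f.
have [gi gc [g' g'c [gK g'K]]] := homeoP g.
split; first by move=> x y xy /=; exact/fi/gi.
- by move=> x; apply: continuous_comp; [exact: gc | exact: fc].
- exists (g' \o f'); last by split; apply: can_comp.
  by move=> x; apply: continuous_comp; [exact: f'c | exact: g'c].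
Qed.

Lemma homeo_inv_ex f : exists h : R -> R,
  increasing_homeo h /\ (cancel f h /\ cancel h f).
Proof.
have [fi fc [h hc [fK hK]]] := homeoP f.
exists h; split=> //; split=> //; last by exists f.
move=> x y xy; rewrite ltNge le_eqVlt; apply/negP => /orP[/eqP hyx|/fi].
- by move: xy; rewrite -[x]hK -[y]hK hyx ltxx.
- by rewrite !hK => /(lt_trans xy); rewrite ltxx.
Qed.

Definition homeo_one : homeo R := Homeo (asboolT increasing_homeo_id).
Definition homeo_mul f g : homeo R := Homeo (asboolT (increasing_homeo_comp f g)).
Definition homeo_inv f : homeo R :=
  Homeo (asboolT (proj1 (projT2 (cid (homeo_inv_ex f))))).

Lemma homeoK f : cancel f (homeo_inv f).
Proof. by rewrite /homeo_inv /=; case: cid => h [] ? []. Qed.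

Lemma homeoVK f : cancel (homeo_inv f) f.
Proof. by rewrite /homeo_inv /=; case: cid => h [] ? []. Qed.

Fact homeo_mulA : associative homeo_mul.
Proof. by move=> f g h; exact: homeo_ext. Qed.
Fact homeo_mul1g : left_id homeo_one homeo_mul.
Proof. by move=> f; exact: homeo_ext. Qed.
Fact homeo_mulg1 : right_id homeo_one homeo_mul.
Proof. by move=> f; exact: homeo_ext. Qed.
Fact homeo_mulVg : left_inverse homeo_one homeo_inv homeo_mul.
Proof. by move=> f; apply: homeo_ext => x /=; exact: homeoK. Qed.
Fact homeo_mulgV : right_inverse homeo_one homeo_inv homeo_mul.
Proof. by move=> f; apply: homeo_ext => x /=; exact: homeoVK. Qed.

HB.instance Definition _ := isGroup.Build (homeo R)
  homeo_mulA homeo_mul1g homeo_mulg1 homeo_mulVg homeo_mulgV.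

End HomeoGroup.

Section FiniteMeasures.
Variables (R : realType) (T : groupType).
Implicit Types mu : T -> R.

(* A finitely supported measure on T is given by its mass function. *)
Definition msupport mu : set T := [set g | mu g != 0].

Definition finsupp_probability mu : Prop :=
  [/\ forall g, 0 <= mu g, finite_set (msupport mu) &
      \sum_(g \in msupport mu) mu g = 1].

Definition symmetric_measure mu : Prop := forall g, mu g = mu (g^-1)%g.

Definition generated_group (S : set T) : set T :=
  smallest (fun H : set T => group_closed [in H]) S.

End FiniteMeasures.

(* \sum_(_ \in A) only ranges over the terms of A that are non-zero, so each
   of these sums is finite when mu has finite support. *)
Definition image_measure (R : realType) (T U : groupType) (phi : T -> U)
  (mu : T -> R) : U -> R := fun k => \sum_(g \in phi @^-1` [set k]) mu g.

Section Actions.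
Variable R : realType.
Implicit Types G : set (homeo R).

Definition irreducible_action G : Prop :=
  ~ exists x : R, forall g, G g -> g x = x.

Definition orbit_of G (x : R) : set R := [set (g : homeo R) x | g in G].

Definition discrete_orbit (O : set R) : Prop := closed O /\ O `<=` isolated O.

(* [bar] is only meaningful on G; its values outside of G are irrelevant. *)
Definition semi_conjugate G (Gbar : set (homeo R)) (bar : homeo R -> homeo R)
    : Prop :=
  [/\ {in G &, {morph bar : g h / (g * h)%g}},
      bar @` G = Gbar &
      exists D : R -> R,
        [/\ forall y, exists x, D x = y,
            {homo D : x y / x <= y},
            continuous D &
            forall x g, G g -> D (g x) = bar g (D x)]].

Definition derriennic_pair G (mu : homeo R -> R) : Prop :=
  [/\ finsupp_probability mu, symmetric_measure mu,
      generated_group (msupport mu) = G, irreducible_action G &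
      forall x : R, \sum_(g \in msupport mu) mu g * g x = x].

End Actions.

(* Main.v *)
(* The semi-conjugacy D is a nondecreasing, continuous, surjective solution of
   sum_g mu(g) D(g x) = D(x); the level sets of such a D are permuted by G, and
   the property of the induced action is this equation.

   Existence of a nondecreasing solution. With x_n the orbit of 0 under the
   maximum of the elements of the support and y_n its orbit under the minimum,
   the probability h_n(x) of leaving [y_n, x_n] through the right is
   nondecreasing and harmonic on [y_n, x_n]. Harmonicity gives a Harnack
   inequality h(g b) - h(g a) <= (h(b) - h(a)) / mu(g), so that the h_n,
   normalised on [x_0, x_1], are locally bounded and have a limit D along an
   ultrafilter.

   Rigidity. If homeomorphisms of R indexed by g have a drift
   c(x) = sum_g mu(g) g(x) - x that is nonincreasing, then c = 0: by symmetry of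
   mu, 2 c is the slope of the sum of the nonnegative areas
   mu(g) int_b^(g b) (b - g^-1 t) dt, and a nonnegative concave function on R is
   constant. If moreover there is a common fixed point, these areas vanish and
   the action is trivial. A nondecreasing V with nonincreasing drift reduces to
   this case by filling its jumps and by extending the action by the identity
   outside of the range of V.

   Applied to D, rigidity shows that D is unbounded on both sides. Applied to D
   with its jumps truncated at height t, whose drift is nonincreasing by
   convexity of s |-> max(s - t, 0), it shows that this function of the jumps is
   harmonic for all t > 0, so that the jump of D is constant along the orbits.
   A nonzero jump would then produce a discrete orbit: D is continuous. *)
Require Import Defs.
From HB Require Import structures.
From mathcomp Require Import all_boot all_order all_algebra.
From mathcomp Require Import all_classical all_reals all_analysis.
From mathcomp Require Import measurable_realfun finmap ring lra.
Set Implicit Arguments.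
Unset Strict Implicit.
Unset Printing Implicit Defensive.
Import Order.TTheory GRing.Theory Num.Theory.
Import numFieldNormedType.Exports.
Local Open Scope classical_set_scope.
Local Open Scope ring_scope.

(** * Averages with respect to a symmetric measure *)

Definition mean (R : realType) (T : groupType) (mu F : T -> R) : R :=
  \sum_(g \in msupport mu) mu g * F g.

Section Mean.
Variables (R : realType) (T : groupType) (mu : T -> R).
Hypothesis mu_prob : finsupp_probability mu.
Implicit Types F : T -> R.

Let S := fset_set (msupport mu).

Let in_S g : g \in S -> msupport mu g.
Proof. by have [_ fS _] := mu_prob; rewrite /S in_fset_set// => /set_mem. Qed.

Let meanE F : mean mu F = \sum_(g <- S) mu g * F g.
Proof. by have [_ fS _] := mu_prob; rewrite /mean fsbig_finite. Qed.

Lemma msupport_gt0 g : msupport mu g -> 0 < mu g.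
Proof. by have [mu0 _ _] := mu_prob => /= Sg; rewrite lt0r mu0 andbT. Qed.

Lemma eq_mean F F' : (forall g, msupport mu g -> F g = F' g) ->
  mean mu F = mean mu F'.
Proof. by move=> FF'; apply: eq_fsbigr => g /set_mem /FF' ->. Qed.

Lemma meanD F F' : mean mu (fun g => F g + F' g) = mean mu F + mean mu F'.
Proof. by rewrite !meanE -big_split; apply: eq_bigr => g _; rewrite mulrDr. Qed.

Lemma meanZ k F : mean mu (fun g => k * F g) = k * mean mu F.
Proof. by rewrite !meanE big_distrr; apply: eq_bigr => g _; rewrite /= mulrCA. Qed.

Lemma meanB F F' : mean mu (fun g => F g - F' g) = mean mu F - mean mu F'.
Proof.
rewrite -(mulN1r (mean mu F')) -meanZ -meanD.
by apply: eq_mean => g _; rewrite mulN1r.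
Qed.

Lemma mean_cst k : mean mu (fun=> k) = k.
Proof.
have [_ fS mu1] := mu_prob.
by rewrite /mean -mulr_fsuml mu1 mul1r.
Qed.

Lemma ler_mean F F' : (forall g, msupport mu g -> F g <= F' g) ->
  mean mu F <= mean mu F'.
Proof.
move=> FF'; rewrite !meanE big_seq [leRHS]big_seq.
apply: ler_sum => g /in_S Sg; rewrite ler_wpM2l ?FF'//.
exact/ltW/msupport_gt0.
Qed.

Lemma mean_ge0 F : (forall g, msupport mu g -> 0 <= F g) -> 0 <= mean mu F.
Proof. by move=> F0; rewrite -(mean_cst 0); exact: ler_mean. Qed.

Lemma ler_mean_term F g : (forall h, msupport mu h -> 0 <= F h) ->
  msupport mu g -> mu g * F g <= mean mu F.
Proof.
move=> F0 Sg; have [_ fS _] := mu_prob.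
rewrite /mean (fsbigD1 g)//= lerDl; apply: fsumr_ge0 => h [Sh _].
by rewrite mulr_ge0 ?F0// ltW// msupport_gt0.
Qed.

Lemma mean_eq0 F g : (forall h, msupport mu h -> 0 <= F h) -> mean mu F <= 0 ->
  msupport mu g -> F g = 0.
Proof.
move=> F0 mF0 Sg; apply/eqP; rewrite eq_le F0// andbT.
by rewrite -(pmulr_rle0 _ (msupport_gt0 Sg)) (le_trans (ler_mean_term F0 Sg)).
Qed.

Lemma cvg_mean (U : Type) (flt : set_system U) {FF : Filter flt}
    (F : T -> U -> R) (l : T -> R) :
  (forall g, msupport mu g -> F g u @[u --> flt] --> l g) ->
  mean mu (F ^~ u) @[u --> flt] --> mean mu l.
Proof.
move=> Fl.
have -> : (fun u => mean mu (F ^~ u)) =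
    (fun u => \sum_(g <- S | g \in S) mu g * F g u).
  by apply/funext => u; rewrite meanE big_seq.
rewrite meanE big_seq; apply: cvg_big => [|g /in_S Sg].
  by move=> [x y]; exact: add_continuous.
by apply: cvgM; [exact: cvg_cst|exact: Fl].
Qed.

Hypothesis mu_sym : symmetric_measure mu.

Lemma msupportV g : msupport mu g -> msupport mu g^-1%g.
Proof. by rewrite /msupport /= -mu_sym. Qed.

Lemma meanV F : mean mu (fun g => F g^-1%g) = mean mu F.
Proof.
rewrite /mean [RHS](@reindex_fsbig _ _ _ _ _ (fun g : T => g^-1%g) (msupport mu)).
  by apply: eq_fsbigr => g _; rewrite -mu_sym.
split=> [g /msupportV//|g h _ _|g Sg]; first exact: invg_inj.
by exists g^-1%g; [exact: msupportV|rewrite invgK].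
Qed.

End Mean.

(** * Actions with nonincreasing drift *)

(** Serves twice: for the integral of a monotone function, and for the sum of the truncated jumps
    over an interval. *)
Lemma additive_primitive (R : realType) (I : R -> R -> R) :
  (forall a b c, a <= b -> b <= c -> I a c = I a b + I b c) ->
  exists F : R -> R, forall a b, a <= b -> F b - F a = I a b.
Proof.
move=> ID; exists (fun x => if 0 <= x then I 0 x else - I x 0) => a b ab.
case: (leP 0 a) => [a0|a0].
  by rewrite (le_trans a0 ab) (ID 0 a b)//; ring.
case: (leP 0 b) => [b0|b0]; first by rewrite (ID a 0 b)// 1?ltW//; ring.
by rewrite (ID a b 0)// 1?ltW//; ring.
Qed.

(** The integral of [k] is convex, and the inequality says that [k y] is a subgradient at [y]. *)
Lemma monotone_primitive (R : realType) (k : R -> R) : {homo k : x y / x <= y} ->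
  exists F : R -> R, forall x y, F y - F x <= k y * (y - x).
Proof.
move=> knd; pose I a b := \int[@lebesgue_measure R]_(t in `]a, b]) k t.
have finI (a b : R) : (lebesgue_measure (`]a, b]%classic : set R) < +oo)%E.
  by rewrite lebesgue_measure_itv/=; case: ifP => // _; rewrite -EFinB ltry.
have intk a b : (@lebesgue_measure R).-integrable `]a, b] (EFin \o k).
  apply: measurable_bounded_integrable => //; first exact: finI.
    exact: nondecreasing_measurable.
  exists (`|k a| + `|k b|); split; rewrite ?num_real// => z zab x /=.
  rewrite in_itv/= => /andP[ax xb]; apply: le_trans (ltW zab).
  have := knd _ _ (ltW ax); have := knd _ _ xb.
  have := ler_norm (k b); have := ler_norm (- k a); rewrite normrN.
  by rewrite ler_norml; have := normr_ge0 (k a); have := normr_ge0 (k b); lra.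
have intc a b (r : R) : (@lebesgue_measure R).-integrable `]a, b] (EFin \o cst r).
  apply: measurable_bounded_integrable => //; first exact: finI.
  by exists `|r|; split; rewrite ?num_real// => z rz x _; exact: ltW.
have cstI a b (r : R) : a <= b ->
    \int[@lebesgue_measure R]_(t in `]a, b]) (cst r t) = r * (b - a).
  rewrite le_eqVlt => /predU1P[->|ab].
    by rewrite set_itvxx Rintegral_set0 subrr mulr0.
  rewrite Rintegral_cst//; congr (r * _).
  have -> : b - a = fine (b - a)%:E by [].
  congr fine; apply: etrans (lebesgue_measure_itv _) _.
  by rewrite /= lte_fin ab.
have leI a b : a <= b -> k a * (b - a) <= I a b <= k b * (b - a).
  move=> ab; rewrite -!cstI//; apply/andP; split; apply: le_Rintegral => // x;
    by rewrite /= in_itv/= => /andP[/ltW ax xb]; exact: knd.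
have [|F FE] := @additive_primitive R I.
  move=> a b c ab bc; rewrite /I (@itv_bndbnd_setU _ _ _ (BRight b))// Rintegral_setU//.
    by rewrite -itv_bndbnd_setU.
  apply/disj_setPS => x [/=]; rewrite !in_itv/= => /andP[_ xb] /andP[].
  by rewrite ltNge xb.
exists F => x y; have [xy|/ltW yx] := leP x y.
  by rewrite FE//; case/andP: (leI _ _ xy).
by rewrite -opprB FE// -(opprB x) mulrN lerN2; case/andP: (leI _ _ yx).
Qed.

Lemma mul_exp2_bounded_le0 (R : realType) (a K : R) :
  (forall n : nat, a * (2 ^+ n) <= K) -> a <= 0.
Proof.
move=> aK; rewrite leNgt; apply/negP => a0.
have K0 : 0 <= K by apply: le_trans (aK 0%N); rewrite mulr1 ltW.
have := aK (Num.bound (K / a)); apply/negP; rewrite -ltNge.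
rewrite -ltr_pdivrMl// mulrC (lt_trans (archi_boundP _))//.
  by rewrite divr_ge0// ltW.
by rewrite -natrX ltr_nat ltn_expl.
Qed.

(* Each bisection of [a, b] halves the bound on the increment of psi. *)
Lemma bisection_le (R : realType) (a b : R) (psi m : R -> R) :
  (forall x y, a <= x -> x <= y -> psi y - psi x <= (y - x) * (m y - m x)) ->
  a <= b -> psi b <= psi a.
Proof.
move=> psim ab.
have H n : forall x y, a <= x -> x <= y ->
    (psi y - psi x) * 2 ^+ n <= (y - x) * (m y - m x).
  elim: n => [x y ax xy|n IHn x y ax xy]; first by rewrite expr0 mulr1 psim.
  pose z := (x + y) / 2.
  have xz : x <= z by rewrite /z; lra.
  have zy : z <= y by rewrite /z; lra.
  have -> : (psi y - psi x) * 2 ^+ n.+1 =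
      2 * ((psi y - psi z) * 2 ^+ n + (psi z - psi x) * 2 ^+ n).
    by rewrite exprS; ring.
  have -> : (y - x) * (m y - m x) =
      2 * ((y - z) * (m y - m z) + (z - x) * (m z - m x)).
    by rewrite /z; field.
  by rewrite ler_pM2l// lerD// IHn// (le_trans ax).
by rewrite -subr_le0; apply: mul_exp2_bounded_le0 => n; exact: H.
Qed.

Section Area.
Variables (R : realType) (T : groupType) (mu : T -> R) (h : T -> R -> R).
Hypothesis mu_prob : finsupp_probability mu.
Hypothesis mu_sym : symmetric_measure mu.
Hypothesis h_homo : forall g, msupport mu g -> {homo h g : x y / x <= y}.
Hypothesis hK : forall g, msupport mu g -> cancel (h g) (h g^-1%g).

Let c y := mean mu (h ^~ y) - y.
Hypothesis c_ni : forall x y, x <= y -> c y <= c x.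

Let hVK g : msupport mu g -> cancel (h g^-1%g) (h g).
Proof. by move=> Sg; rewrite -{2}(invgK g); apply/hK/msupportV. Qed.

(* Phi g b is the integral of b - h g^-1 t for t between b and h g b. By
   Young's equality for h g and its inverse, and by the symmetry of mu, its mean
   over g has slope 2 c in b. *)
Lemma drift_area : exists Phi : T -> R -> R,
  [/\ forall g b, msupport mu g -> 0 <= Phi g b,
      forall g b, msupport mu g -> h g b = b -> Phi g b = 0,
      forall g b, msupport mu g -> Phi g b = 0 -> h g b = b &
      forall x y, mean mu (Phi ^~ y) - mean mu (Phi ^~ x) <=
        (y - x) * (2 * c y + (y - x))].
Proof.
have /choice[F FE] g : exists F : R -> R, msupport mu g ->
    forall x y, F y - F x <= h g y * (y - x).
  have [Sg|/negP Sg] := boolP (mu g != 0); last by exists id.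
  by have [F FE] := monotone_primitive (h_homo Sg); exists F.
pose Phi g b := b * (h g b - b) - (F g^-1%g (h g b) - F g^-1%g b).
(* Young's equality by bisection: over [[u, v]] the expression varies, in either direction, by at
   most [(v - u) * (h g v - h g u)]. *)
have young g x y : msupport mu g -> x <= y ->
    y * h g y - F g y - F g^-1%g (h g y) = x * h g x - F g x - F g^-1%g (h g x).
  move=> Sg; have SVg := msupportV mu_sym Sg.
  have FVE u v : F g^-1%g (h g v) - F g^-1%g (h g u) <= v * (h g v - h g u).
    by rewrite (le_trans (FE _ SVg _ _))// hK.
  move=> xy; apply/eqP; rewrite eq_le -[X in _ && X]lerN2; apply/andP; split.
  - apply: (@bisection_le _ x y
      (fun z => z * h g z - F g z - F g^-1%g (h g z)) (h g)) => // u v _ uv.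
    by have := FVE v u; have := FE _ Sg v u; nra.
  - apply: (@bisection_le _ x y
      (fun z => - (z * h g z - F g z - F g^-1%g (h g z))) (h g)) => // u v _ uv.
    by have := FVE u v; have := FE _ Sg u v; nra.
(* Young's equality trades [F g^-1%g (h g b)] for [b * h g b - F g b] up to a constant, so the
   increments of [Phi] become symmetric in [g] and its inverse. *)
have PhiE g x y : msupport mu g -> Phi g y - Phi g x =
    F g y - F g x + (F g^-1%g y - F g^-1%g x) - (y - x) * (y + x).
  move=> Sg; rewrite /Phi; have [xy|/ltW yx] := leP x y.
    by have := young g _ _ Sg xy; lra.
  by have := young g _ _ Sg yx; lra.
exists Phi; split.
- move=> g b Sg; rewrite /Phi subr_ge0.
  by rewrite (le_trans (FE _ (msupportV mu_sym Sg) _ _))// hK.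
- by move=> g b Sg; rewrite /Phi => ->; rewrite !subrr mulr0 subrr.
- move=> g b Sg; rewrite /Phi => /eqP; rewrite subr_eq0 => /eqP Pb.
  have FV := FE _ (msupportV mu_sym Sg).
  (* At the midpoint [m] of [b] and [u], the two subgradient inequalities are compatible with a
     vanishing area only if [(h g^-1%g m - b) * (m - b)] is nonnegative. If [u] differed from [b],
     this would put [m] at [u] or beyond it. *)
  set u := h g b in Pb *; pose m := (u + b) / 2.
  have kum : F g^-1%g u - F g^-1%g m <= b * (u - m) by rewrite (le_trans (FV _ _))// hK.
  have kmb := FV b m.
  have hmono v : (h g^-1%g v <= b -> v <= u) * (b <= h g^-1%g v -> u <= v).
    by split=> /(h_homo Sg); rewrite hVK.
  have [ub|ub|//] := ltgtP u b.
    have : m <= u by apply: (hmono _).1; move: kum kmb; rewrite /m; nra.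
    by rewrite /m; lra.
  have : u <= m by apply: (hmono _).2; move: kum kmb; rewrite /m; nra.
  by rewrite /m; lra.
- move=> x y; rewrite -meanB//.
  apply: (@le_trans _ _ (mean mu (fun g => (y - x) * (h g y + h g^-1%g y) +
      - ((y - x) * (y + x))))).
    apply: ler_mean => // g Sg; rewrite PhiE//.
    by have := FE _ Sg x y; have := FE _ (msupportV mu_sym Sg) x y; lra.
  rewrite meanD// mean_cst// meanZ// meanD// (meanV mu_sym (h ^~ y)) /c.
  by rewrite le_eqVlt; apply/orP; left; apply/eqP; ring.
Qed.

(** Bisection removes the quadratic error of [drift_area], and the monotonicity of [c] replaces the
    local slope by the slope at [x]: the mean area is concave, with supergradient [2 * c x]. *)
Lemma mean_le_tangent : exists Phi : T -> R -> R,
  [/\ forall g b, msupport mu g -> 0 <= Phi g b,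
      forall g b, msupport mu g -> h g b = b -> Phi g b = 0,
      forall g b, msupport mu g -> Phi g b = 0 -> h g b = b &
      forall x y, mean mu (Phi ^~ y) <= mean mu (Phi ^~ x) + 2 * c x * (y - x)].
Proof.
have [Phi [P0 P1 P2 P3]] := drift_area; exists Phi; split=> // x y.
set P := fun z => mean mu (Phi ^~ z); rewrite -/(P y) -/(P x).
have [xy|/ltW yx] := leP x y.
  suff : P y - 2 * c x * y <= P x - 2 * c x * x by lra.
  apply: (@bisection_le _ x y (fun z => P z - 2 * c x * z) id) => // u v xu uv.
  by have := P3 u v; have := c_ni (le_trans xu uv); rewrite -/(P u) -/(P v); nra.
(* Bisection compares a point with those to its right, so the case of [y] left of [x] is
   reflected. *)
suff : P (- - y) + 2 * c x * (- y) <= P (- - x) + 2 * c x * (- x).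
  by rewrite !opprK; lra.
apply: (@bisection_le _ (- x) (- y) (fun z => P (- z) + 2 * c x * z) id).
  move=> u v xu uv.
  have vx : - v <= x by lra.
  by have := P3 (- u) (- v); have := c_ni vx; rewrite -/(P (- u)) -/(P (- v)); nra.
by lra.
Qed.

Lemma drift_eq0 y : mean mu (h ^~ y) = y.
Proof.
have [Phi [P0 _ _ P3]] := mean_le_tangent.
apply/eqP; rewrite -subr_eq0 -/(c y); apply/eqP.
have Pge0 z : 0 <= mean mu (Phi ^~ y) + 2 * c y * (z - y).
  by rewrite (le_trans _ (P3 y z))// mean_ge0// => g; exact: P0.
apply/eqP; apply/negPn/negP => cy.
(* The point where the tangent line of slope [2 * c y] takes the value -1, although it bounds a
   nonnegative area from above. *)
have := Pge0 (y - (mean mu (Phi ^~ y) + 1) / (2 * c y)).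
have -> : mean mu (Phi ^~ y) +
    2 * c y * (y - (mean mu (Phi ^~ y) + 1) / (2 * c y) - y) = - 1 by field.
by rewrite ler0N1.
Qed.

(** Since the drift is zero, the tangent at the fixed point is flat, at height 0; the nonnegative
    areas therefore vanish everywhere. *)
Lemma fixed_drift_trivial y0 : (forall g, msupport mu g -> h g y0 = y0) ->
  forall g y, msupport mu g -> h g y = y.
Proof.
move=> y0P g y Sg.
have [Phi [P0 P1 P2 P3]] := mean_le_tangent.
apply: P2 => //; apply: (mean_eq0 mu_prob (F := Phi ^~ y)) => //.
  by move=> k Sk; exact: P0.
rewrite (le_trans (P3 y0 y))// /c drift_eq0 subrr mulr0 mul0r addr0.
rewrite (@eq_mean _ _ _ _ (fun=> 0)) ?mean_cst// => k Sk.
by rewrite P1// y0P.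
Qed.

End Area.

(** * Monotone functions with nonincreasing drift on a totally ordered set *)

Section OrderedAction.
Variables (R : realType) (T : groupType) (mu : T -> R).
Variables (Omega : Type) (le : Omega -> Omega -> Prop).
Variables (act : T -> Omega -> Omega) (W : Omega -> R).
Hypothesis mu_prob : finsupp_probability mu.
Hypothesis mu_sym : symmetric_measure mu.
Hypothesis le_total : forall a b, le a b \/ le b a.
Hypothesis act_le : forall g, msupport mu g -> {homo act g : a b / le a b}.
Hypothesis actK : forall g, msupport mu g -> cancel (act g) (act g^-1%g).
Hypothesis W_le : {homo W : a b / le a b >-> a <= b}.

Let c a := mean mu (fun g => W (act g a)) - W a.
Hypothesis c_ni : forall a b, le a b -> c b <= c a.

Lemma actVK g : msupport mu g -> cancel (act g^-1%g) (act g).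
Proof. by move=> Sg; rewrite -{2}(invgK g); exact/actK/msupportV. Qed.

(** For [a] before [b] on the same level, the nonnegative increments [W (act g b) - W (act g a)]
    have mean [c b - c a], which is at most 0. Thus the action descends to the range of [W]. *)
Lemma act_level g a b : msupport mu g -> W a = W b ->
  W (act g a) = W (act g b).
Proof.
move=> Sg; wlog ab : a b / le a b.
  by move=> wl; have [/wl//|/wl ba /esym/ba/esym] := le_total a b.
move=> Wab; apply/esym/eqP; rewrite -subr_eq0; apply/eqP.
apply: (mean_eq0 mu_prob (F := fun g => W (act g b) - W (act g a))) => //.
  by move=> k Sk; rewrite subr_ge0; exact/W_le/act_le.
by rewrite meanB//; have := c_ni ab; rewrite /c Wab; lra.
Qed.

Lemma act_homo g a b : msupport mu g -> W a <= W b -> W (act g a) <= W (act g b).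
Proof.
move=> Sg Wab; have [ab|ba] := le_total a b; first exact/W_le/act_le.
by rewrite (act_level Sg (_ : W a = W b))//; apply/eqP; rewrite eq_le Wab W_le.
Qed.

Lemma drift_homo a b : W a <= W b -> c b <= c a.
Proof.
move=> Wab; have [/c_ni//|/W_le Wba] := le_total a b.
have {}Wab : W a = W b by apply/eqP; rewrite eq_le Wab.
by rewrite /c Wab (eq_mean (fun g Sg => act_level Sg Wab)).
Qed.

(** A negative drift at [a] persists, at least as negative, at all higher levels; but close to the
    supremum of [W] there is no room for a loss of [- c a]. *)
Lemma drift_ge0 : has_ubound (range W) -> forall a, 0 <= c a.
Proof.
move=> ubW a; rewrite leNgt; apply/negP => ca.
have supW : has_sup (range W) by split => //; exists (W a), a.
have ca0 : 0 < - c a by rewrite oppr_gt0.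
have [_ [b _ <-] supb] := sup_adherent ca0 supW.
have Wsup w : W w <= sup (range W) by apply: ub_le_sup => //; exists w.
have [d [Wad supd]] : exists d, W a <= W d /\ sup (range W) + c a < W d.
  have [ab|/ltW ba] := leP (W a) (W b); last exists a; first exists b; split => //.
    by rewrite opprK in supb.
  by rewrite opprK in supb; exact: lt_le_trans ba.
(* [w] dominates the images of [d]; as the support is stable under inverses, every image of [w] then
   lies at or above the level of [d]. *)
have [w [dw actw]] : exists w, W d <= W w /\
    forall g, msupport mu g -> W (act g d) <= W w.
  have [_ /finite_seqP[s sE] _] := mu_prob; rewrite sE /=.
  elim: s {sE} => [|g s [w [dw IHw]]]; first by exists d.
  have [gw|/ltW wg] := leP (W (act g d)) (W w).
    exists w; split=> // k; rewrite in_cons => /predU1P[->//|]; exact: IHw.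
  exists (act g d); split; first exact: le_trans wg.
  by move=> k; rewrite in_cons => /predU1P[->//|/IHw/le_trans]; exact.
have := drift_homo (le_trans Wad dw); rewrite {1}/c.
have : W d <= mean mu (fun g => W (act g w)).
  rewrite -[leLHS](mean_cst mu_prob); apply: ler_mean => // g Sg.
  rewrite -{1}(actVK Sg d); apply: act_homo => //.
  exact/actw/msupportV.
by have := Wsup w; lra.
Qed.

End OrderedAction.

Section OrderedActionDrift.
Variables (R : realType) (T : groupType) (mu : T -> R).
Variables (Omega : Type) (le : Omega -> Omega -> Prop).
Variables (act : T -> Omega -> Omega) (W : Omega -> R).
Hypothesis mu_prob : finsupp_probability mu.
Hypothesis mu_sym : symmetric_measure mu.
Hypothesis le_total : forall a b, le a b \/ le b a.
Hypothesis act_le : forall g, msupport mu g -> {homo act g : a b / le a b}.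
Hypothesis actK : forall g, msupport mu g -> cancel (act g) (act g^-1%g).
Hypothesis W_le : {homo W : a b / le a b >-> a <= b}.

Let c a := mean mu (fun g => W (act g a)) - W a.
Hypothesis c_ni : forall a b, le a b -> c b <= c a.
Hypothesis W_ivt : forall a b y, W a <= y -> y <= W b -> exists w, W w = y.

Lemma drift_le0 : has_lbound (range W) -> forall a, c a <= 0.
Proof.
move=> [m mW] a.
have cN b : mean mu (fun g => - W (act g b)) - - W b = - c b.
  rewrite /c opprB opprK addrC -[in RHS]mulN1r.
  by rewrite -meanZ//; congr (_ + _); apply: eq_mean => g _; rewrite mulN1r.
have := @drift_ge0 R T mu Omega (fun a b => le b a) act (fun a => - W a)
  mu_prob mu_sym _ _ actK _ _ _ a; rewrite cN oppr_ge0; apply.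
- by move=> u v; rewrite or_comm.
- by move=> g Sg u v uv; exact: act_le.
- by move=> u v uv; rewrite lerN2 W_le.
- by move=> u v uv; rewrite !cN lerN2 c_ni.
- by exists (- m) => _ [w _ <-]; rewrite lerN2; apply: mW; exists w.
Qed.

(* Extending the induced action by the identity outside of the range of W makes
   any point out of a bounded range a common fixed point. *)
Let h g y : R :=
  if pselect (exists w, W w = y) is left yW then W (act g (projT1 (cid yW)))
  else y.

Let hE g w : msupport mu g -> h g (W w) = W (act g w).
Proof.
move=> Sg; rewrite /h; case: pselect => [yW|[]]; last by exists w.
by case: cid => v /= vw; apply: (act_level mu_prob le_total act_le W_le c_ni).
Qed.

Let h_out g y : ~ (exists w, W w = y) -> h g y = y.
Proof. by rewrite /h; case: pselect. Qed.

Let out_lt a y : ~ (exists w, W w = y) -> W a <= y -> forall b, W b < y.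
Proof.
move=> yW ay b; rewrite ltNge; apply/negP => yb.
by apply: yW; exact: (W_ivt ay yb).
Qed.

Let out_gt a y : ~ (exists w, W w = y) -> y <= W a -> forall b, y < W b.
Proof.
move=> yW ya b; rewrite ltNge; apply/negP => yb.
by apply: yW; exact: (W_ivt yb ya).
Qed.

Let h_homo g : msupport mu g -> {homo h g : x y / x <= y}.
Proof.
move=> Sg x y xy.
have [[a ax]|xW] := pselect (exists w, W w = x); last first.
  have [[b byE]|yW] := pselect (exists w, W w = y); last by rewrite !h_out.
  rewrite -byE hE// h_out//; rewrite -byE in xy.
  exact/ltW/(out_gt xW xy).
have [[b byE]|yW] := pselect (exists w, W w = y); last first.
  rewrite -ax hE// [h g y]h_out//; rewrite -ax in xy.
  exact/ltW/(out_lt yW xy).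
move: xy; rewrite -ax -byE !hE// => xy.
by apply: (act_homo mu_prob le_total act_le W_le c_ni).
Qed.

Let hK g : msupport mu g -> cancel (h g) (h g^-1%g).
Proof.
move=> Sg y; have [[a <-]|yW] := pselect (exists w, W w = y).
  by rewrite hE// hE ?actK//; exact: msupportV.
by rewrite !(h_out _ yW).
Qed.

Let mean_hE a : mean mu (h ^~ (W a)) - W a = c a.
Proof. by rewrite /c; congr (_ - _); apply: eq_mean => g Sg; rewrite hE. Qed.

Let mean_h_out y : ~ (exists w, W w = y) -> mean mu (h ^~ y) - y = 0.
Proof.
move=> yW; rewrite (@eq_mean _ _ _ _ (fun=> y)) ?mean_cst ?subrr// => g _.
exact: h_out.
Qed.

(** A point outside of the range has zero drift and, by [W_ivt], has the whole range on one side.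
    The range is then bounded on that side, and the sign of [c] is given by [drift_le0] or
    [drift_ge0]. *)
Let mean_h_ni x y : x <= y -> mean mu (h ^~ y) - y <= mean mu (h ^~ x) - x.
Proof.
move=> xy.
have [[a ax]|xW] := pselect (exists w, W w = x); last first.
  have [[b byE]|yW] := pselect (exists w, W w = y); last by rewrite !mean_h_out.
  rewrite -byE mean_hE mean_h_out//; rewrite -byE in xy; apply: drift_le0.
  by exists x => _ [w _ <-]; exact/ltW/(out_gt xW xy).
have [[b byE]|yW] := pselect (exists w, W w = y); last first.
  rewrite -ax mean_hE [leLHS]mean_h_out//; rewrite -ax in xy.
  apply: (drift_ge0 mu_prob mu_sym le_total act_le actK W_le c_ni) => //.
  by exists y => _ [w _ <-]; exact/ltW/(out_lt yW xy).
move: xy; rewrite -ax -byE !mean_hE => xy.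
by apply: (drift_homo mu_prob le_total act_le W_le c_ni).
Qed.

Lemma ordered_action_drift_eq0 a : mean mu (fun g => W (act g a)) = W a.
Proof.
have := drift_eq0 mu_prob mu_sym h_homo hK mean_h_ni (W a) => <-.
by apply: eq_mean => g Sg; rewrite hE.
Qed.

Lemma ordered_action_bounded :
  has_ubound (range W) \/ has_lbound (range W) ->
  forall g a, msupport mu g -> W (act g a) = W a.
Proof.
move=> Wb g a Sg; rewrite -hE//.
have [y yW] : exists y, ~ (exists w, W w = y).
  case: Wb => [[m mW]|[m mW]]; [exists (m + 1)|exists (m - 1)] => -[w Ww].
    have : W w <= m by apply: mW; exists w.
    by rewrite Ww; lra.
  have : m <= W w by apply: mW; exists w.
  by rewrite Ww; lra.
apply: (fixed_drift_trivial mu_prob mu_sym h_homo hK mean_h_ni (y0 := y)) => //.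
by move=> k Sk; exact: h_out.
Qed.

End OrderedActionDrift.

(** * Nondecreasing functions with nonincreasing drift *)

Section OneSidedLimits.
Variables (R : realType).
Implicit Types (V : R -> R) (x y : R).

Definition llim V x : R := lim (V y @[y --> x^'-]).
Definition rlim V x : R := lim (V y @[y --> x^'+]).

Variable V : R -> R.
Hypothesis V_nd : {homo V : x y / x <= y}.

Lemma cvg_llim x : V y @[y --> x^'-] --> llim V x.
Proof.
apply: nondecreasing_at_left_is_cvgr; first by near=> z => a b _ _; exact: V_nd.
near=> z; exists (V x) => _ [y + <-]; rewrite /= in_itv/= => /andP[_ /ltW yx].
exact: V_nd.
Unshelve. all: by end_near. Qed.

Lemma cvg_rlim x : V y @[y --> x^'+] --> rlim V x.
Proof.
apply: nondecreasing_at_right_is_cvgr; first by near=> z => a b _ _; exact: V_nd.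
near=> z; exists (V x) => _ [y + <-]; rewrite /= in_itv/= => /andP[/ltW xy _].
exact: V_nd.
Unshelve. all: by end_near. Qed.

Lemma llim_le x : llim V x <= V x.
Proof.
apply: (cvgr_to_le (@cvg_llim x)); near=> y; apply/V_nd/ltW.
by near: y; exact: nbhs_left_lt.
Unshelve. all: by end_near. Qed.

Lemma le_llim x y : x < y -> V x <= llim V y.
Proof.
move=> xy; apply: (cvgr_to_ge (@cvg_llim y)); near=> z; apply/V_nd/ltW.
by near: z; exact: nbhs_left_gt.
Unshelve. all: by end_near. Qed.

Lemma le_rlim x : V x <= rlim V x.
Proof.
apply: (cvgr_to_ge (@cvg_rlim x)); near=> y; apply/V_nd/ltW.
by near: y; exact: nbhs_right_gt.
Unshelve. all: by end_near. Qed.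

Lemma rlim_le x y : x < y -> rlim V x <= V y.
Proof.
move=> xy; apply: (cvgr_to_le (@cvg_rlim x)); near=> z; apply/V_nd/ltW.
by near: z; exact: nbhs_right_lt.
Unshelve. all: by end_near. Qed.

Lemma homeo_cvg_left (g : homeo R) x : g y @[y --> x^'-] --> (g x)^'-.
Proof.
have [gi gc _] := homeoP g => P /= gP; have := gc x _ gP.
rewrite /= !near_simpl /at_left /within /=; apply: filterS => y /= Py yx.
exact/Py/gi.
Qed.

Lemma homeo_cvg_right (g : homeo R) x : g y @[y --> x^'+] --> (g x)^'+.
Proof.
have [gi gc _] := homeoP g => P /= gP; have := gc x _ gP.
rewrite /= !near_simpl /at_right /within /=; apply: filterS => y /= Py yx.
exact/Py/gi.
Qed.

Lemma cvg_llim_homeo (g : homeo R) x : V (g y) @[y --> x^'-] --> llim V (g x).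
Proof. by apply: cvg_comp (@cvg_llim (g x)); exact: homeo_cvg_left. Qed.

Lemma cvg_rlim_homeo (g : homeo R) x : V (g y) @[y --> x^'+] --> rlim V (g x).
Proof. by apply: cvg_comp (@cvg_rlim (g x)); exact: homeo_cvg_right. Qed.

End OneSidedLimits.

Lemma homeo_homo (R : realType) (g : homeo R) : {homo g : x y / x < y}.
Proof. by have [] := homeoP g. Qed.

Lemma homeo_homo_le (R : realType) (g : homeo R) : {homo g : x y / x <= y}.
Proof. exact/ltW_homo/homeo_homo. Qed.

Lemma homeo_invK (R : realType) (g : homeo R) : cancel g (g^-1)%g.
Proof. exact: homeoK. Qed.

Lemma homeo_invVK (R : realType) (g : homeo R) : cancel (g^-1)%g g.
Proof. exact: homeoVK. Qed.

(* The jumps of V are filled in: (x, s) is the point dividing the interval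
   [llim V x, rlim V x] in the ratio s : 1 - s, and homeomorphisms act by
   affine maps between these intervals. *)
Section FilledJumps.
Variables (R : realType) (mu : homeo R -> R) (V : R -> R).
Hypothesis mu_prob : finsupp_probability mu.
Hypothesis mu_sym : symmetric_measure mu.
Hypothesis V_nd : {homo V : x y / x <= y}.

Let c x := mean mu (fun g => V (g x)) - V x.
Hypothesis c_ni : forall x y, x <= y -> c y <= c x.

Let cL x := mean mu (fun g => llim V (g x)) - llim V x.
Let cR x := mean mu (fun g => rlim V (g x)) - rlim V x.

Let cvg_cL x : c y @[y --> x^'-] --> cL x.
Proof.
apply: cvgB; last exact: cvg_llim.
by apply: cvg_mean => // g _; exact: cvg_llim_homeo.
Qed.

Let cvg_cR x : c y @[y --> x^'+] --> cR x.
Proof.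
apply: cvgB; last exact: cvg_rlim.
by apply: cvg_mean => // g _; exact: cvg_rlim_homeo.
Qed.

Let c_le_cL x : c x <= cL x.
Proof.
apply: (cvgr_to_ge (@cvg_cL x)); near=> y; apply/c_ni/ltW.
by near: y; exact: nbhs_left_lt.
Unshelve. all: by end_near. Qed.

Let cL_le x y : x < y -> cL y <= c x.
Proof.
move=> xy; apply: (cvgr_to_le (@cvg_cL y)); near=> z; apply/c_ni/ltW.
by near: z; exact: nbhs_left_gt.
Unshelve. all: by end_near. Qed.

Let cR_le_c x : cR x <= c x.
Proof.
apply: (cvgr_to_le (@cvg_cR x)); near=> y; apply/c_ni/ltW.
by near: y; exact: nbhs_right_gt.
Unshelve. all: by end_near. Qed.

Let le_cR x y : x < y -> c y <= cR x.
Proof.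
move=> xy; apply: (cvgr_to_ge (@cvg_cR x)); near=> z; apply/c_ni/ltW.
by near: z; exact: nbhs_right_lt.
Unshelve. all: by end_near. Qed.

Let mid (x y : R) : x < y -> x < (x + y) / 2 < y.
Proof. by move=> xy; apply/andP; split; lra. Qed.

Let rlim_le_llim (x y : R) : x < y -> rlim V x <= llim V y.
Proof.
by move=> /mid/andP[xz zy]; exact: le_trans (rlim_le V_nd xz) (le_llim V_nd zy).
Qed.

Let cL_le_cR (x y : R) : x < y -> cL y <= cR x.
Proof.
by move=> /mid/andP[xz zy]; exact: le_trans (cL_le zy) (le_cR xz).
Qed.

Let unitP (s : R) : Prop := 0 <= s <= 1.
Let Omega := (R * {s : R | 0 <= s <= 1})%type.
Let W (a : Omega) := llim V a.1 + \val a.2 * (rlim V a.1 - llim V a.1).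
Let act (g : homeo R) (a : Omega) : Omega := (g a.1, a.2).
Let le (a b : Omega) := a.1 < b.1 \/ a.1 = b.1 /\ \val a.2 <= \val b.2.

Let le_total a b : le a b \/ le b a.
Proof.
rewrite /le; have [ab|ab|->] := ltgtP a.1 b.1; [by left; left|by right; left|].
by have [|/ltW] := leP (\val a.2) (\val b.2); [left|right]; right.
Qed.

Let act_le g : msupport mu g -> {homo act g : a b / le a b}.
Proof.
move=> _ a b [ab|[ab sab]]; first by left; exact: homeo_homo.
by right; rewrite /= ab.
Qed.

Let actK g : msupport mu g -> cancel (act g) (act g^-1%g).
Proof. by move=> _ [x s]; congr pair; exact: homeo_invK. Qed.

Let jump_ge0 x : 0 <= rlim V x - llim V x.
Proof. by rewrite subr_ge0 (le_trans (llim_le V_nd x))// le_rlim. Qed.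

Let W_ge (a : Omega) : llim V a.1 <= W a.
Proof.
by rewrite /W lerDl mulr_ge0//; case: (a.2) => s /= /andP[].
Qed.

Let W_le_rlim a : W a <= rlim V a.1.
Proof.
rewrite /W addrC -lerBrDr ler_piMl//.
by case: (a.2) => s /= /andP[].
Qed.

Let W_le : {homo W : a b / le a b >-> a <= b}.
Proof.
move=> a b [ab|[ab sab]].
  rewrite (le_trans (W_le_rlim a))// (le_trans _ (W_ge b))//.
  exact: rlim_le_llim.
by rewrite /W ab lerD2l ler_wpM2r.
Qed.

Let mean_W a : mean mu (fun g => W (act g a)) - W a =
  (1 - \val a.2) * cL a.1 + \val a.2 * cR a.1.
Proof.
rewrite /W /act /= meanD// meanZ// meanB// /cL /cR; ring.
Qed.

(** The drift at [(x, s)] interpolates from [cL x] to [cR x], with [cR x <= c x <= cL x], so it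
    decreases along each filled jump; [cL_le_cR] compares distinct jumps. *)
Let cW_ni a b : le a b ->
  mean mu (fun g => W (act g b)) - W b <= mean mu (fun g => W (act g a)) - W a.
Proof.
have := le_trans (cR_le_c a.1) (c_le_cL a.1).
have := le_trans (cR_le_c b.1) (c_le_cL b.1).
rewrite !mean_W /le; case: a b => [x [s s01]] [y [t t01]] /=.
case/andP: (s01) => s0 s1; case/andP: (t01) => t0 t1.
move=> yLR xLR [|[]] xy; last by rewrite -xy in yLR * => st; nra.
have {}xy := cL_le_cR xy.
apply: (@le_trans _ _ (cL y)); first by nra.
by apply: (le_trans xy); nra.
Qed.

Let W_ivt a b y : W a <= y -> y <= W b -> exists w, W w = y.
Proof.
move=> ay yb.
suff [x Lx Rx] : exists2 x, llim V x <= y & y <= rlim V x.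
  have [LR|LR] := eqVneq (rlim V x) (llim V x).
    have s01 : 0 <= (0 : R) <= 1 by rewrite lexx ler01.
    exists (x, exist unitP 0 s01); rewrite /W /= mul0r addr0.
    by apply/eqP; rewrite eq_le Lx -LR.
  have LR0 : 0 < rlim V x - llim V x by rewrite lt0r jump_ge0 subr_eq0 LR.
  have s01 : 0 <= (y - llim V x) / (rlim V x - llim V x) <= 1.
    apply/andP; split; first by apply: divr_ge0; [rewrite subr_ge0|exact: ltW].
    by rewrite ler_pdivrMr// mul1r lerD2r.
  by exists (x, exist unitP _ s01); rewrite /W /= divfK ?gt_eqF// addrC subrK.
(* [V] crosses the level [y] at [sup A]; the points to the left of [a.1] make [A] nonempty. *)
pose A := [set z | z < a.1 \/ V z < y].
have Aub : ubound A (Num.max a.1 b.1).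
  move=> z [/ltW za|Vzy]; first by rewrite le_max za.
  rewrite le_max; apply/orP; right; rewrite leNgt; apply/negP => bz.
  have := le_lt_trans (le_trans yb (le_trans (W_le_rlim b) (rlim_le V_nd bz))) Vzy.
  by rewrite ltxx.
have supA : has_sup A.
  by split; [exists (a.1 - 1); left; lra|exists (Num.max a.1 b.1)].
exists (sup A).
  apply: (cvgr_to_le (cvg_llim V_nd (x := sup A))); near=> z.
  have zA : z < sup A by near: z; exact: nbhs_left_lt.
  have [u [ua|Vuy] zu] := sup_gt supA.1 zA; last first.
    exact: le_trans (V_nd (ltW zu)) (ltW Vuy).
  exact: le_trans (le_llim V_nd (lt_trans zu ua)) (le_trans (W_ge a) ay).
apply: (cvgr_to_ge (cvg_rlim V_nd (x := sup A))); near=> z.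
have zA : sup A < z by near: z; exact: nbhs_right_gt.
rewrite leNgt; apply/negP => Vzy.
have : z <= sup A by apply: ub_le_sup; [exact: supA.2|right].
by rewrite leNgt zA.
Unshelve. all: by end_near. Qed.

Let zero01 : 0 <= (0 : R) <= 1. Proof. by rewrite lexx ler01. Qed.
Let one01 : 0 <= (1 : R) <= 1. Proof. by rewrite lexx ler01. Qed.

Let cW_eq0 (a : Omega) : (1 - \val a.2) * cL a.1 + \val a.2 * cR a.1 = 0.
Proof.
rewrite -mean_W (ordered_action_drift_eq0 mu_prob mu_sym le_total act_le actK
  W_le cW_ni W_ivt); exact: subrr.
Qed.

(** At the two ends of the filled jump the drift is [cL x] and [cR x]; both vanish, and [c x] lies
    between them. *)
Lemma monotone_drift_eq0 x : mean mu (fun g => V (g x)) = V x.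
Proof.
apply/eqP; rewrite -subr_eq0 -/(c x) eq_le; apply/andP; split.
  have := cW_eq0 (x, exist unitP 0 zero01) => /= => <-.
  by rewrite mul0r subr0 mul1r addr0.
have := cW_eq0 (x, exist unitP 1 one01) => /= => <-.
by rewrite subrr mul0r mul1r add0r.
Qed.

Lemma monotone_bounded : has_ubound (range V) \/ has_lbound (range V) ->
  forall g x, msupport mu g -> rlim V (g x) = rlim V x.
Proof.
move=> Vb g x Sg.
have WRE z : W (z, exist unitP 1 one01) = rlim V z.
  by rewrite /W /= mul1r addrC subrK.
rewrite -!WRE.
apply: (ordered_action_bounded mu_prob mu_sym le_total act_le actK W_le cW_ni W_ivt
  _ (x, exist unitP 1 one01) Sg).
case: Vb => -[m mV]; [left|right]; exists m => _ [a _ <-].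
  apply: le_trans (W_le_rlim a) _; apply: le_trans (rlim_le V_nd (_ : _ < a.1 + 1)) _.
    by rewrite ltrDl.
  by apply: mV; exists (a.1 + 1).
apply: le_trans (W_ge a).
apply: le_trans (le_llim V_nd (_ : a.1 - 1 < _)); last by rewrite ltrBlDr ltrDl.
by apply: mV; exists (a.1 - 1).
Qed.

End FilledJumps.

(** * Harmonic functions on a bounded window *)

Lemma finite_set_max (R : realType) (T : choiceType) (A : set T) (F : T -> R)
    (x : R) : finite_set A ->
  exists y, [/\ x <= y, forall g, A g -> F g <= y &
                y = x \/ exists2 g, A g & y = F g].
Proof.
move=> /finite_seqP[s ->] /=; elim: s => [|g s [y [xy ys yE]]].
  by exists x; split=> //; left.
have [gy|/ltW yg] := leP (F g) y.
  exists y; split=> // [k|].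
    by rewrite in_cons => /predU1P[->//|]; exact: ys.
  case: yE => [|[k ks]]; [by left|right; exists k => //=].
  by rewrite in_cons ks orbT.
exists (F g); split; first exact: le_trans yg.
  by move=> k; rewrite in_cons => /predU1P[->//|/ys/le_trans]; exact.
by right; exists g => //=; rewrite in_cons eqxx.
Qed.

Section WindowProblem.
Variables (R : realType) (mu : homeo R -> R).
Hypothesis mu_prob : finsupp_probability mu.

Definition window_harmonic (q p : R) (h : R -> R) : Prop :=
  {homo h : x y / x <= y} /\
  forall x, q <= x <= p -> mean mu (fun g => h (g x)) = h x.

(* The minimal solution: h x is the probability that the random walk started
   at x leaves [q, p] through the right. *)
Lemma window_problem (q p : R) : q <= p -> exists h : R -> R,
  [/\ window_harmonic q p h, forall x, p < x -> h x = 1 &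
      forall x, x < q -> h x = 0].
Proof.
move=> qp.
pose step (u : R -> R) (x : R) : R :=
  if p < x then 1 else if x < q then 0 else mean mu (fun g => u (g x)).
pose u0 (x : R) : R := if p < x then 1 else 0.
pose good (u : R -> R) := {homo u : x y / x <= y} /\ forall x, 0 <= u x <= 1.
have step_le u v : (forall x, u x <= v x) -> forall x, step u x <= step v x.
  move=> uv x; rewrite /step; case: ifP => // _; case: ifP => // _.
  exact: ler_mean.
have mean01 u x : good u -> 0 <= mean mu (fun g => u (g x)) <= 1.
  move=> [_ u01]; apply/andP; split.
    by apply: mean_ge0 => // g _; case/andP: (u01 (g x)).
  rewrite -[leRHS](mean_cst mu_prob); apply: ler_mean => // g _.
  by case/andP: (u01 (g x)).
have good_step u : good u -> good (step u).
  move=> gu; have [u_nd u01] := gu; split=> [x y xy|x]; rewrite /step.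
    have [px|xp] := ltP p x; first by rewrite (lt_le_trans px xy).
    have [py|yp] := ltP p y.
      case: ifP => _; first by rewrite ler01.
      by case/andP: (mean01 u x gu).
    have [xq|qx] := ltP x q.
      by case: ifP => // _; case/andP: (mean01 u y gu).
    rewrite ltNge (le_trans qx xy) /=; apply: ler_mean => // g _.
    exact/u_nd/homeo_homo_le.
  case: ifP => _; first by rewrite ler01 lexx.
  by case: ifP => _; [rewrite ler01 lexx|exact: mean01].
have good_u0 : good u0.
  split=> [x y xy|x]; rewrite /u0; last by case: ifP; rewrite ?ler01 ?lexx.
  have [px|xp] := ltP p x; first by rewrite (lt_le_trans px xy).
  by case: ifP; rewrite ?ler01.
(* [u n x] is the probability of leaving through the right within [n] steps; it increases with
   [n]. *)
pose u n := iter n step u0.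
have good_u n : good (u n) by elim: n => //= n; exact: good_step.
have u_le n x : u n x <= u n.+1 x.
  elim: n x => [x|n IHn x]; last exact: step_le.
  rewrite /u /= /step /u0; case: ifP => // _; case: ifP => // _.
  by case/andP: (mean01 u0 x good_u0).
have cvg_u x : u n x @[n --> \oo] --> lim (u n x @[n --> \oo]).
  apply: nondecreasing_is_cvgn.
    by apply/nondecreasing_seqP => n; exact: u_le.
  by exists 1 => _ [n _ <-]; case/andP: ((good_u n).2 x).
pose h x : R := lim (u n x @[n --> \oo]).
have hE x : h x = step h x.
  apply: cvg_lim => //; rewrite -(cvg_shiftS (u ^~ x)).
  rewrite /= /u /= /step; case: ifP => // _; first exact: cvg_cst.
  case: ifP => // _; first exact: cvg_cst.
  by apply: cvg_mean => // g _; exact: cvg_u.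
exists h; split; first split.
- move=> x y xy; apply: (ler_cvg_to (cvg_u x) (cvg_u y)).
  by near=> n; exact: (good_u n).1.
- by move=> x /andP[qx xp]; rewrite [RHS]hE /step ltNge xp /= ltNge qx.
- by move=> x px; rewrite hE /step px.
- by move=> x xq; rewrite hE /step xq ltNge (le_trans (ltW xq) qp).
Unshelve. all: by end_near. Qed.

End WindowProblem.

Lemma ultra_bounded_cvg (R : realType) (T : Type) (U : set_system T)
    (UU : UltraFilter U) (f : T -> R) (B : R) :
  U (fun n => `|f n| <= B) -> exists l : R, f n @[n --> U] --> l.
Proof.
move=> UB.
have [|l [_ ll]] := @segment_compact R (- B) B (f @ U) _.
  by rewrite /fmap /=; apply: filterS UB => n; rewrite /= in_itv/= ler_norml.
exists l => A nA; have [//|UAC] := in_ultra_setVsetC (f @^-1` A) UU.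
by have [x [/= ? ?]] := ll (~` A) A UAC nA.
Qed.

Section HarmonicFunction.
Variables (R : realType) (mu : homeo R -> R).
Hypothesis mu_prob : finsupp_probability mu.
Hypothesis mu_sym : symmetric_measure mu.
Hypothesis mu_irr : forall x, exists2 g, msupport mu g & g x != x.

Let SV g : msupport mu g -> msupport mu g^-1%g := @msupportV _ _ _ mu_sym g.

Lemma moved_right x : exists2 g, msupport mu g & x < g x.
Proof.
have [g Sg] := mu_irr x; rewrite neq_lt => /orP[gx|xg]; last by exists g.
exists (g^-1)%g; first exact: SV.
by rewrite -{1}(homeo_invK g x); exact: homeo_homo.
Qed.

Lemma moved_left x : exists2 g, msupport mu g & g x < x.
Proof.
have [g Sg xg] := moved_right x; exists (g^-1)%g; first exact: SV.
by rewrite -{2}(homeo_invK g x); exact: homeo_homo.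
Qed.

(** Some element of the support moves a finite supremum to the right, and with it the points of [A]
    close enough to the supremum beyond it; likewise for an infimum. *)
Lemma invariant_set_unbounded (A : set R) : A !=set0 ->
  (forall g x, msupport mu g -> A x -> A (g x)) ->
  (forall b, exists2 a, A a & b < a) /\ (forall b, exists2 a, A a & a < b).
Proof.
move=> A0 gA; split=> b; apply: contrapT => nA.
  have supA : has_sup A.
    by split=> //; exists b => a Aa; rewrite leNgt; apply/negP => ?; apply: nA; exists a.
  have [g Sg xg] := moved_right (sup A).
  have : (g^-1)%g (sup A) < sup A.
    by rewrite -{2}(homeo_invK g (sup A)); exact: homeo_homo.
  move=> /(sup_gt supA.1)[a Aa /(@homeo_homo R g)]; rewrite homeo_invVK => ga.
  have : g a <= sup A by apply: ub_le_sup; [exact: supA.2|exact: gA].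
  by rewrite leNgt ga.
have infA : has_inf A.
  by split=> //; exists b => a Aa; rewrite leNgt; apply/negP => ?; apply: nA; exists a.
have [g Sg xg] := moved_left (inf A).
have : inf A < (g^-1)%g (inf A).
  by rewrite -{1}(homeo_invK g (inf A)); exact: homeo_homo.
move=> /(inf_lt infA.1)[a Aa /(@homeo_homo R g)]; rewrite homeo_invVK => ga.
have : inf A <= g a by apply: ge_inf; [exact: infA.2|exact: gA].
by rewrite leNgt ga.
Qed.

Lemma max_move : exists M : R -> R, forall x,
  [/\ x < M x, forall g, msupport mu g -> g x <= M x &
      exists2 g, msupport mu g & M x = g x].
Proof.
suff /choice[M ME] : forall x : R, exists y : R, [/\ x < y,
  forall g, msupport mu g -> g x <= y & exists2 g, msupport mu g & y = g x].
  by exists M.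
move=> x.
have [_ fS _] := mu_prob.
have [y [xy yS yE]] := finite_set_max (fun g : homeo R => g x) x fS.
have [g Sg xg] := moved_right x.
have {}xy := lt_le_trans xg (yS g Sg).
by exists y; split=> //; case: yE => // yx; rewrite yx ltxx in xy.
Qed.

Lemma min_move : exists m : R -> R, forall x,
  [/\ m x < x, forall g, msupport mu g -> m x <= g x &
      exists2 g, msupport mu g & m x = g x].
Proof.
suff /choice[m mE] : forall x : R, exists y : R, [/\ y < x,
  forall g, msupport mu g -> y <= g x & exists2 g, msupport mu g & y = g x].
  by exists m.
move=> x.
have [_ fS _] := mu_prob.
have [y [xy yS yE]] := finite_set_max (fun g : homeo R => - g x) (- x) fS.
have [g Sg xg] := moved_left x.
have {}xy : - y < x by have := yS g Sg; lra.
exists (- y); split=> //; first by move=> k /yS; lra.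
case: yE => [yx|[k Sk yk]]; last by exists k => //; rewrite yk opprK.
by move: xy; rewrite yx opprK ltxx.
Qed.

(** [h y - h x] is the average of the nonnegative increments [h (g y) - h (g x)], of which one term
    is kept. [C] bounds every [(mu g)^-1] and is the same for all windows. *)
Lemma harnack_constant : exists2 C : R, 1 <= C &
  forall q p h, window_harmonic mu q p h -> forall g x y, msupport mu g ->
  q <= x -> x <= y -> y <= p -> h (g y) - h (g x) <= C * (h y - h x).
Proof.
have [_ fS _] := mu_prob.
have [C [C1 CS _]] := finite_set_max (fun g : homeo R => (mu g)^-1) 1 fS.
exists C => // q p h [h_nd hh] g x y Sg qx xy yp.
have mug := msupport_gt0 mu_prob Sg.
apply: (@le_trans _ _ ((mu g)^-1 * (h y - h x))); last first.
  by rewrite ler_wpM2r ?CS// subr_ge0 h_nd.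
rewrite -ler_pdivrMl ?invr_gt0// invrK.
rewrite -(hh x) ?qx ?(le_trans xy yp)// -(hh y) ?yp ?(le_trans qx xy)//.
rewrite -meanB//.
apply: (ler_mean_term mu_prob (F := fun g => h (g y) - h (g x))) => // k _.
by rewrite subr_ge0; exact/h_nd/homeo_homo_le.
Qed.

End HarmonicFunction.

(** * Existence of a nondecreasing harmonic function *)

Section HarmonicLimit.
Variables (R : realType) (mu : homeo R -> R).
Hypothesis mu_prob : finsupp_probability mu.
Hypothesis mu_sym : symmetric_measure mu.
Hypothesis mu_irr : forall x, exists2 g, msupport mu g & g x != x.

Let SV g : msupport mu g -> msupport mu g^-1%g := @msupportV _ _ _ mu_sym g.

Lemma normalized_window : exists (q p B : nat -> R) (D : nat -> R -> R),
  [/\ forall x, exists n, q n <= x <= p n,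
      forall n N, (n <= N)%N -> q N <= q n /\ p n <= p N,
      forall N, window_harmonic mu (q N) (p N) (D N),
      forall N, D N 0 = 0 /\ D N (p 0%N) = 1 &
      forall n N x, (n <= N)%N -> q n <= x <= p n -> `|D N x| <= B n].
Proof.
have [M ME] := max_move mu_prob mu_sym mu_irr.
have [m mE] := min_move mu_prob mu_sym mu_irr.
(* The support is stable under inverses, so the largest and the smallest move are inverse to each
   other. *)
have MK y : m (M y) = y.
  have [yM MS [g Sg Mg]] := ME y; have [_ mS [k Sk mk]] := mE (M y).
  apply/eqP; rewrite eq_le; apply/andP; split.
    rewrite (le_trans (mS _ (SV Sg)))// Mg.
    by have -> : (g^-1)%g (g y) = y by exact: homeo_invK.
  by rewrite mk -{1}(homeo_invVK k y) homeo_homo_le ?MS//; exact: SV.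
have mK y : M (m y) = y.
  have [my mS [g Sg mg]] := mE y; have [_ MS [k Sk Mk]] := ME (m y).
  apply/eqP; rewrite eq_le; apply/andP; split.
    by rewrite Mk -[leRHS](homeo_invVK k y) homeo_homo_le ?mS//; exact: SV.
  rewrite (le_trans _ (MS _ (SV Sg)))// mg.
  by have -> : (g^-1)%g (g y) = y by exact: homeo_invK.
pose p n := iter n M 0; pose q n := iter n m 0.
have p_lt n : p n < p n.+1 by case: (ME (p n)).
have q_lt n : q n.+1 < q n by case: (mE (q n)).
have p_le n N : (n <= N)%N -> p n <= p N.
  by move: n N; apply/nondecreasing_seqP => n; exact/ltW/p_lt.
have q_le n N : (n <= N)%N -> q N <= q n.
  by move: n N; apply/nonincreasing_seqP => n; exact/ltW/q_lt.
have p0 n : 0 <= p n := p_le _ _ (leq0n n).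
have q0 n : q n <= 0 := q_le _ _ (leq0n n).
have p_unbounded b : exists n, b < p n.
  have [||+ _] := @invariant_set_unbounded R mu mu_sym mu_irr
      [set x | exists n, x <= p n].
  - by exists 0, 0%N.
  - move=> g x Sg [n xn]; exists n.+1; rewrite (le_trans (homeo_homo_le g xn))//.
    by have [_ MS _] := ME (p n); exact: MS.
  - by move=> /(_ b)[a [n an] ba]; exists n; exact: lt_le_trans an.
have q_unbounded b : exists n, q n < b.
  have [||_] := @invariant_set_unbounded R mu mu_sym mu_irr
      [set x | exists n, q n <= x].
  - by exists 0, 0%N.
  - move=> g x Sg [n xn]; exists n.+1; rewrite (le_trans _ (homeo_homo_le g xn))//.
    by have [_ mS _] := mE (q n); exact: mS.
  - by move=> /(_ b)[a [n an] ab]; exists n; exact: le_lt_trans ab.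
have [C C1 CE] := harnack_constant mu_prob.
have C0 : 0 <= C := le_trans ler01 C1.
pose B n : R := \sum_(i < n.+1) C ^+ i.+1.
suff /choice[D DE] (N : nat) : exists D : R -> R,
    [/\ window_harmonic mu (q N.+1) (p N.+1) D, D 0 = 0, D (p 1%N) = 1 &
        forall n x, (n <= N.+1)%N -> q n <= x <= p n -> `|D x| <= B n].
  (* The shift by one makes [p 1], where the functions are normalised to 1, the initial endpoint and
     places it in every window. *)
  exists (q \o succn), (p \o succn), (B \o succn), D; split=> [x|n N nN|N|N|n N x nN].
  - have [i xi] := p_unbounded x; have [j xj] := q_unbounded x.
    exists (maxn i j); apply/andP; split.
      by rewrite (le_trans _ (ltW xj))// q_le// (leq_trans (leq_maxr i j)).
    by rewrite (le_trans (ltW xi))// p_le// (leq_trans (leq_maxl i j)).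
  - by split; [exact: q_le|exact: p_le].
  - by case: (DE N).
  - by case: (DE N).
  - by case: (DE N) => _ _ _; apply.
have [h [hw h1 h0]] := window_problem mu_prob (le_trans (q0 N.+1) (p0 N.+1)).
have [h_nd _] := hw; have harnack := CE _ _ _ hw.
pose d := h (p 1%N) - h 0.
(* If [g] realises the largest move at [p n.+1], then [g^-1] sends [p n.+1] to a point not below
   [p n]. So [[p n.+1, p n.+2]] is the image of a part of [[p n, p n.+1]], and each step costs a
   factor [C]. *)
have up n : (n <= N.+1)%N -> h (p n.+1) - h (p n) <= C ^+ n.+1 * d.
  elim: n => [_|n IHn nN].
    by rewrite expr1 ler_peMl// subr_ge0 h_nd// p0.
  have [pM _ [g Sg Mg]] := ME (p n.+1).
  have [mp mS _] := mE (p n.+1).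
  have {mS} := mS _ (SV Sg); rewrite [m (p n.+1)]MK => pg.
  rewrite exprS -mulrA; apply: le_trans (ler_wpM2l C0 (IHn (ltnW nN))).
  apply: (@le_trans _ _ (C * (h (p n.+1) - h ((g^-1)%g (p n.+1))))); last first.
    by rewrite ler_wpM2l// lerD2l lerN2 h_nd.
  have gp : (g^-1)%g (p n.+1) <= p n.+1.
    rewrite -[leRHS](homeo_invK g); apply: homeo_homo_le.
    by rewrite -Mg ltW.
  have := harnack g _ _ Sg (le_trans (q0 N.+1) (le_trans (p0 n) pg)) gp (p_le _ _ nN).
  by rewrite homeo_invVK -Mg.
have down n : (n <= N.+1)%N -> h (q n) - h (q n.+1) <= C ^+ n.+1 * d.
  elim: n => [_|n IHn nN].
    (* The first interval on the left, [[q 1, 0]], is compared with [[0, p 1]]. *)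
    have [qm _ [g Sg mg]] := mE 0.
    have [_ MS _] := ME 0; have {MS} := MS _ (SV Sg) => gM.
    have g0 : 0 <= (g^-1)%g 0.
      rewrite -{1}(homeo_invK g 0); apply: homeo_homo_le.
      by rewrite -mg ltW.
    have gp : (g^-1)%g 0 <= p N.+1 by rewrite (le_trans gM)//; exact: (p_le 1%N).
    have := harnack g _ _ Sg (q0 N.+1) g0 gp.
    rewrite homeo_invVK -mg expr1 => /le_trans; apply.
    by rewrite ler_wpM2l// lerD2r h_nd.
  have [qm _ [g Sg mg]] := mE (q n.+1).
  have [_ MS _] := ME (q n.+1).
  have {MS} := MS _ (SV Sg); rewrite [M (q n.+1)]mK => gq.
  rewrite exprS -mulrA; apply: le_trans (ler_wpM2l C0 (IHn (ltnW nN))).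
  apply: (@le_trans _ _ (C * (h ((g^-1)%g (q n.+1)) - h (q n.+1)))); last first.
    by rewrite ler_wpM2l// lerD2r h_nd.
  have qg : q n.+1 <= (g^-1)%g (q n.+1).
    rewrite -[leLHS](homeo_invK g); apply: homeo_homo_le.
    by rewrite -mg ltW.
  have := harnack g _ _ Sg (q_le _ _ nN) qg (le_trans gq (le_trans (q0 n) (p0 N.+1))).
  by rewrite homeo_invVK -mg.
have d_ge0 : 0 <= d by rewrite subr_ge0 h_nd// p0.
have BS n : B n.+1 = B n + C ^+ n.+2 by rewrite /B big_ord_recr.
have upB n : (n <= N.+1)%N -> h (p n.+1) - h 0 <= B n * d.
  elim: n => [_|n IHn nN]; first by rewrite /B big_ord1; exact: (up 0%N).
  by rewrite BS mulrDl; have := up _ nN; have := IHn (ltnW nN); lra.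
have downB n : (n <= N.+1)%N -> h 0 - h (q n.+1) <= B n * d.
  elim: n => [_|n IHn nN]; first by rewrite /B big_ord1; exact: (down 0%N).
  by rewrite BS mulrDl; have := down _ nN; have := IHn (ltnW nN); lra.
(* The bounds reach one step beyond the window on each side, where [h] is 1 and 0; with [d = 0]
   these values would coincide. *)
have d_gt0 : 0 < d.
  rewrite lt0r d_ge0 andbT; apply/negP => /eqP d0.
  have := upB _ (leqnn N.+1); have := downB _ (leqnn N.+1).
  by rewrite d0 !mulr0 (h1 _ (p_lt _)) (h0 _ (q_lt _)); lra.
exists (fun x => (h x - h 0) / d); split.
- split=> [x y xy|x xw]; first by rewrite ler_pM2r ?invr_gt0// lerD2r h_nd.
  rewrite (@eq_mean _ _ _ _ (fun g : homeo R => d^-1 * (h (g x) - h 0))); last first.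
    by move=> g _; rewrite mulrC.
  by rewrite meanZ// meanB// mean_cst// hw.2// mulrC.
- by rewrite subrr mul0r.
- by rewrite divff// gt_eqF.
- move=> n x nN /andP[qx xp].
  rewrite normrM (gtr0_norm (_ : 0 < d^-1)) ?invr_gt0// ler_pdivrMr//.
  have := upB _ nN; have := downB _ nN.
  have := h_nd _ _ (le_trans xp (ltW (p_lt n))).
  have := h_nd _ _ (le_trans (ltW (q_lt n)) qx).
  by rewrite ler_norml; lra.
Qed.

(** Each point lies in all windows from some index on, so its bound and its harmonicity hold along
    the ultrafilter. The normalisation at 0 and [p 0] keeps the limit from being constant. *)
Lemma exists_harmonic : exists D : R -> R,
  [/\ {homo D : x y / x <= y}, forall x, mean mu (fun g => D (g x)) = D x &
      exists a b, D a < D b].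
Proof.
have [q [p [B [D [qp_ex qp_le Dw D01 DB]]]]] := normalized_window.
have [U [UU UF]] := @ultraFilterLemma nat \oo _.
have UP : ProperFilter U := @ultra_proper _ _ UU.
have near_window x : \forall N \near U, q N <= x <= p N /\
    `|D N x| <= B (projT1 (cid (qp_ex x))).
  case: cid => n /= nx; apply: UF; exists n => //= N nN; split; last exact: DB.
  have [qq pp] := qp_le _ _ nN; case/andP: nx => qx xp.
  by rewrite (le_trans qq qx) (le_trans xp pp).
have /choice[L LE] (x : R) : exists l : R, D N x @[N --> U] --> l.
  apply: (@ultra_bounded_cvg _ _ U UU (D ^~ x) (B (projT1 (cid (qp_ex x))))).
  by apply: filterS (near_window x) => N [].
exists L; split.
- move=> x y xy; apply: (ler_cvg_to (LE x) (LE y)).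
  by near=> N; exact: (Dw N).1.
- move=> x.
  have cv : mean mu (fun g => D N (g x)) @[N --> U] --> mean mu (fun g => L (g x)).
    by apply: cvg_mean => // g _; exact: LE.
  suff cv2 : D N x @[N --> U] --> mean mu (fun g => L (g x)).
    exact: (norm_cvg_unique cv2 (LE x)).
  move: cv; apply: cvg_trans; apply: near_eq_cvg; near=> N.
  have [xw _] : q N <= x <= p N /\ `|D N x| <= B (projT1 (cid (qp_ex x))).
    by near: N; exact: near_window.
  by rewrite -((Dw N).2 x xw).
- exists 0, (p 0%N).
  have cst0 : D N 0 @[N --> U] --> (0 : R).
    by under eq_fun do rewrite (D01 _).1; exact: cvg_cst.
  have cst1 : D N (p 0%N) @[N --> U] --> (1 : R).
    by under eq_fun do rewrite (D01 _).2; exact: cvg_cst.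
  rewrite (norm_cvg_unique (LE 0) cst0) (norm_cvg_unique (LE (p 0%N)) cst1).
  exact: ltr01.
Unshelve. all: by end_near. Qed.

(** Harmonicity passes to right limits. Right continuity matters because [monotone_bounded] controls
    only right limits. *)
Lemma exists_rcontinuous_harmonic : exists D : R -> R,
  [/\ {homo D : x y / x <= y}, forall x, mean mu (fun g => D (g x)) = D x,
      forall x, D y @[y --> x^'+] --> D x & exists a b, D a < D b].
Proof.
have [D [D_nd Dh [a [b Dab]]]] := exists_harmonic.
have rD_nd : {homo rlim D : x y / x <= y}.
  move=> x y; rewrite le_eqVlt => /predU1P[->//|xy].
  exact: le_trans (rlim_le D_nd xy) (le_rlim D_nd y).
exists (rlim D); split => //.
- move=> x; suff cv : D y @[y --> x^'+] --> mean mu (fun g => rlim D (g x)).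
    exact: (norm_cvg_unique cv (@cvg_rlim _ _ D_nd x)).
  have cvm : mean mu (fun g => D (g y)) @[y --> x^'+] -->
      mean mu (fun g => rlim D (g x)).
    by apply: cvg_mean => // g _; exact: cvg_rlim_homeo.
  move: cvm; apply: cvg_trans.
  by apply: near_eq_cvg; near=> y; rewrite Dh.
- move=> x; apply/cvgrPdist_lt => e e0.
  have /cvgrPdist_lt/(_ e e0) De := @cvg_rlim _ _ D_nd x.
  have [z xz Dz] : exists2 z, x < z & D z < rlim D x + e.
    have : \forall z \near x^'+, x < z /\ `|rlim D x - D z| < e.
      by near=> z; split; near: z; [exact: nbhs_right_gt|exact: De].
    move=> /(@filter_ex _ _ _ _)[z [xz De']]; exists z => //.
    by move: De'; rewrite ltr_distlC => /andP[].
  near=> y.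
  have xy : x < y by near: y; exact: nbhs_right_gt.
  have yz : y < z by near: y; exact: nbhs_right_lt.
  rewrite ltr_distlC (lt_le_trans _ (rD_nd _ _ (ltW xy))) ?gtrBl//=.
  exact: le_lt_trans (rlim_le D_nd yz) Dz.
- exists (a - 1), b; rewrite (le_lt_trans (rlim_le D_nd (_ : _ < a)))//.
    by rewrite ltrBlDr ltrDl.
  exact: lt_le_trans (le_rlim D_nd b).
Unshelve. all: by end_near. Qed.

End HarmonicLimit.

(** * Continuity of harmonic functions *)

Section Jumps.
Variables (R : realType) (D : R -> R).
Hypothesis D_nd : {homo D : x y / x <= y}.

(** The gap on the left, which is the whole jump of a right-continuous function. *)
Definition jump x : R := D x - llim D x.

Lemma jump_ge0 x : 0 <= jump x.
Proof. by rewrite subr_ge0 llim_le. Qed.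

Lemma sum_jump_path a b (s : seq R) : a <= b -> path <%R a s ->
  all (fun x => x <= b) s -> \sum_(x <- s) jump x <= D b - D a.
Proof.
elim: s a => [|x s IHs] a ab /=; first by rewrite big_nil subr_ge0 D_nd.
move=> /andP[ax xs] /andP[xb sb]; rewrite big_cons.
have := IHs x xb xs sb; have := le_llim D_nd ax; rewrite {2}/jump; lra.
Qed.

Lemma sum_jump_le a b (A : set R) : a <= b -> finite_set A ->
  A `<=` `]a, b] -> \sum_(x \in A) jump x <= D b - D a.
Proof.
move=> ab fA Aab; rewrite fsbig_finite// -(perm_big _ (permEl (perm_sort <=%R _))).
have sA x : x \in sort <=%R (fset_set A) -> a < x /\ x <= b.
  rewrite mem_sort in_fset_set// => /set_mem/Aab.
  by rewrite /= in_itv/= => /andP[].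
apply: sum_jump_path => //; last by apply/allP => x /sA[].
rewrite path_min_sorted; last by apply/allP => x /sA[].
by rewrite sort_lt_sorted fset_uniq.
Qed.

Lemma finite_big_jumps a b t : 0 < t ->
  finite_set [set x | x \in `]a, b] /\ t <= jump x].
Proof.
move=> t0; have [ba|ab] := ltP b a.
  rewrite (_ : [set x | _] = set0); first exact: finite_set0.
  apply/seteqP; split=> // x [/=]; rewrite in_itv/= => /andP[ax xb] _.
  by have := lt_trans (le_lt_trans xb ba) ax; rewrite ltxx.
apply: contrapT => /infinite_set_fset infA.
pose n := Num.bound ((D b - D a) / t).
have [B BA nB] := infA n.
have : n%:R * t <= D b - D a.
  apply: (@le_trans _ _ (\sum_(x <- enum_fset B) jump x)).
    apply: (@le_trans _ _ (\sum_(x <- enum_fset B) t)).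
      rewrite big_const_seq count_predT iter_addr_0 -[t *+ _]mulr_natl.
      by rewrite ler_pM2r// ler_nat.
    by rewrite big_seq [leRHS]big_seq; apply: ler_sum => x /BA[].
  rewrite fsbig_seq ?fset_uniq//; apply: sum_jump_le => //; first exact: finite_fset.
  by move=> x /BA[].
rewrite leNgt -ltr_pdivrMr// => /negP; apply.
by apply: archi_boundP; rewrite divr_ge0// ?subr_ge0 ?D_nd// ltW.
Qed.

End Jumps.

Lemma locally_finite_discrete (R : realType) (A : set R) :
  (forall a b, finite_set (A `&` `]a, b])) -> discrete_orbit A.
Proof.
move=> fA.
have cA x (B : set R) : B `<=` A `&` `](x - 1), (x + 1)] -> ~ B x ->
    nbhs x (~` B `&` `](x - 1), (x + 1)[).
  move=> BA Bx; have fB := sub_finite_set BA (fA _ _).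
  have cB : closed B.
    by apply: (accessible_finite_set_closed.1 _ _ fB); exact: hausdorff_accessible.
  apply: filterI; first by apply: open_nbhs_nbhs; split=> //; exact: closed_openC.
  by apply: near_in_itvoo; rewrite in_itv/=; apply/andP; split; lra.
have oc x y : `](x - 1), (x + 1)[%classic y -> `](x - 1), (x + 1)]%classic y.
  by rewrite /= !in_itv/= => /andP[-> /ltW].
split=> [x clx|x Ax].
  apply: contrapT => nAx.
  have /clx[y [Ay [nB /oc xy]]] :
      nbhs x (~` (A `&` `](x - 1), (x + 1)]) `&` `](x - 1), (x + 1)[).
    by apply: cA => // -[].
  exact: nB.
split; first exact: mem_set.
exists (~` ((A `&` `](x - 1), (x + 1)]) `\ x) `&` `](x - 1), (x + 1)[).
  by apply: cA; [move=> y []|case=> _ /(_ erefl)].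
apply/seteqP; split=> [y [[nB /oc xy] Ay]|y ->].
  by apply: contrapT => yx; apply: nB.
split=> //; split; first by case=> _ /(_ erefl).
by rewrite /= in_itv/=; apply/andP; split; lra.
Qed.

(** * Invariance of the jumps of a harmonic function *)

Section HarmonicJumps.
Variables (R : realType) (mu : homeo R -> R) (D : R -> R).
Hypothesis mu_prob : finsupp_probability mu.
Hypothesis mu_sym : symmetric_measure mu.
Hypothesis D_nd : {homo D : x y / x <= y}.
Hypothesis D_harm : forall x, mean mu (fun g => D (g x)) = D x.

Let f := jump D.

Lemma mean_jump x : mean mu (fun g => f (g x)) = f x.
Proof.
rewrite /f /jump meanB// D_harm; congr (_ - _).
suff cv : D y @[y --> x^'-] --> mean mu (fun g => llim D (g x)).
  exact: (norm_cvg_unique cv (@cvg_llim _ _ D_nd x)).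
have cvm : mean mu (fun g => D (g y)) @[y --> x^'-] -->
    mean mu (fun g => llim D (g x)).
  by apply: cvg_mean => // g _; exact: cvg_llim_homeo.
move: cvm; apply: cvg_trans; apply: near_eq_cvg; near=> y; by rewrite D_harm.
Unshelve. all: by end_near. Qed.

(* The measure obtained from dD by truncating its atoms at mass t is a monotone
   function with nonincreasing drift; the vanishing of this drift says that the
   excess of the jumps over t is harmonic. *)
Section Excess.
Variable t : R.
Hypothesis t_gt0 : 0 < t.

Let e x : R := Num.max (f x - t) 0.

Let e_ge0 x : 0 <= e x. Proof. by rewrite le_max lexx orbT. Qed.

Let e_gt x : e x != 0 -> t < f x.
Proof.
by apply: contraNT; rewrite -leNgt -subr_le0 /e => /max_idPr ->.
Qed.

Let le_e x : f x - t <= e x. Proof. by rewrite le_max lexx. Qed.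

Let e_le x : e x <= f x.
Proof. by rewrite ge_max jump_ge0// andbT lerBlDr lerDl ltW. Qed.

(** Jensen's inequality for the truncation, applied to the harmonic function [f]. *)
Let e_sub x : e x <= mean mu (fun g => e (g x)).
Proof.
rewrite {1}/e ge_max mean_ge0 ?andbT//.
by rewrite -(mean_jump x) -[t in X in X <= _](mean_cst mu_prob) -meanB// ler_mean.
Qed.

Let supp a b : set R := [set x | x \in `]a, b] /\ t <= f x].

Let fsupp a b : finite_set (supp a b) := finite_big_jumps D_nd a b t_gt0.

Let E a b : R := \sum_(x \in supp a b) e x.

Let EE a b : E a b = \sum_(x \in `]a, b]) e x.
Proof.
apply: fsbig_widen => [x []//|x [xab nx]]; apply: contrapT => /eqP/e_gt/ltW tx.
exact: nx.
Qed.

Let ED a b c : a <= b -> b <= c -> E a c = E a b + E b c.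
Proof.
move=> ab bc; rewrite /E -fsbigU0//; first last.
  move=> x [[]] + _ []; rewrite !in_itv/= => /andP[_ xb] /andP[bx].
  by rewrite ltNge xb in bx.
apply: eq_fsbigl; apply/seteqP; split=> x.
  move=> [xac tx]; have [xb|bx] := leP x b; [left|right]; split => //;
    by move: xac; rewrite !in_itv/= => /andP[ax xc]; apply/andP.
by move=> [|] [+ tx]; rewrite in_itv/= => /andP[ax xb]; split=> //;
  rewrite in_itv/=; apply/andP; split => //;
  [exact: le_trans bc|exact: le_lt_trans ax].
Qed.

Let E_homeo (g : homeo R) a b : E (g a) (g b) = \sum_(x \in `]a, b]) e (g x).
Proof.
rewrite EE; apply: reindex_fsbig; split.
- move=> x /=; rewrite !in_itv/= => /andP[ax xb].
  by apply/andP; split; [exact: homeo_homo|exact: homeo_homo_le].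
- by move=> x y _ _ gxy; rewrite -(homeo_invK g x) gxy homeo_invK.
- move=> y /=; rewrite in_itv/= => /andP[ay yb]; exists ((g^-1)%g y).
    have ag : a < (g^-1)%g y by rewrite -[a](homeo_invK g); exact: homeo_homo.
    have gb : (g^-1)%g y <= b by rewrite -[b](homeo_invK g); exact: homeo_homo_le.
    by rewrite in_itv; apply/andP; split.
  exact: homeo_invVK.
Qed.

(** A finite set outside of which [e] and all its translates by the support vanish on []a, b]]; over
    it, sums over points and means over [g] can be exchanged. *)
Let K a b : set R :=
  supp a b `|` \bigcup_(g in msupport mu) [set x | x \in `]a, b] /\ t <= f (g x)].

Let fK a b : finite_set (K a b).
Proof.
have [_ fS _] := mu_prob.
rewrite finite_setU; split => //; apply: bigcup_finite => // g _.
have := @finite_image _ _ (supp (g a) (g b)) ((g^-1)%g : homeo R) (fsupp _ _).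
apply: sub_finite_set => x [xab tx]; exists (g x); last exact: homeo_invK.
split=> //; move: xab; rewrite !in_itv/= => /andP[ax xb].
by apply/andP; split; [exact: homeo_homo|exact: homeo_homo_le].
Qed.

Let K_sub a b : K a b `<=` `]a, b].
Proof. by move=> x [[]//|[g _ []]]. Qed.

Let E_K a b : E a b = \sum_(x \in K a b) e x.
Proof.
apply: fsbig_widen => [x|x [Kx nx]]; first by left.
apply: contrapT => /eqP/e_gt/ltW tx; apply: nx; split=> //.
exact: K_sub Kx.
Qed.

Let E_homeo_K g a b : msupport mu g ->
  E (g a) (g b) = \sum_(x \in K a b) e (g x).
Proof.
move=> Sg; rewrite E_homeo; apply/esym/fsbig_widen => [x|x [xab nx]].
  exact: K_sub.
by apply: contrapT => /eqP/e_gt/ltW tx; apply: nx; right; exists g.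
Qed.

Let mean_E a b : mean mu (fun g => E (g a) (g b)) =
  \sum_(x \in K a b) mean mu (fun g => e (g x)).
Proof.
have [_ fS _] := mu_prob.
rewrite (eq_mean (fun g => @E_homeo_K g a b)) /mean.
under eq_fsbigr do rewrite mulr_fsumr.
exact: exchange_fsbig.
Qed.

Let mean_EB a b : mean mu (fun g => E (g a) (g b)) =
  \sum_(x \in K a b) (mean mu (fun g => e (g x)) - e x) + E a b.
Proof.
rewrite mean_E E_K -fsbig_split//; apply: eq_fsbigr => x _.
by rewrite /= subrK.
Qed.

Let E_le a b : a <= b -> E a b <= D b - D a.
Proof.
move=> ab; apply: le_trans (sum_jump_le D_nd ab (fsupp a b) _); last by move=> x [].
by rewrite /E !fsbig_finite//; apply: ler_sum => x _; exact: e_le.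
Qed.

Lemma excess_harmonic x :
  mean mu (fun g => Num.max (f (g x) - t) 0) = Num.max (f x - t) 0.
Proof.
have [F FE] := additive_primitive ED.
(* [F] is a distribution function of the excess, so [V] is [D] with its jumps cut at [t]. Its drift
   is the opposite of that of [F], which is nondecreasing by [e_sub]. *)
pose V y := D y - F y.
have V_nd : {homo V : y z / y <= z}.
  by move=> y z yz; have := E_le yz; rewrite /V -FE//; lra.
have meanV y : mean mu (fun g => V (g y)) = D y - mean mu (fun g => F (g y)).
  by rewrite meanB// D_harm.
have meanF y z : y <= z ->
    mean mu (fun g => F (g z)) - mean mu (fun g => F (g y)) =
    mean mu (fun g => E (g y) (g z)).
  by move=> yz; rewrite -meanB//; apply: eq_mean => g _; rewrite FE// homeo_homo_le.
have cV y z : y <= z -> mean mu (fun g => V (g z)) - V z <=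
    mean mu (fun g => V (g y)) - V y.
  move=> yz; rewrite !meanV /V.
  suff : 0 <= mean mu (fun g => E (g y) (g z)) - E y z.
    by rewrite -meanF// -FE//; lra.
  by rewrite mean_EB addrK fsumr_ge0// => u _; rewrite subr_ge0.
have V_harm := monotone_drift_eq0 mu_prob mu_sym V_nd cV.
have x1x : x - 1 <= x by rewrite gerBl.
(* The drift of [V] vanishes at both ends of []x - 1, x]], so the nonnegative defects of harmonicity
   of [e] in this interval add up to 0. *)
have Kx0 : \sum_(y \in K (x - 1) x) (mean mu (fun g => e (g y)) - e y) = 0.
  have := mean_EB (x - 1) x; rewrite -meanF// -FE//.
  by have := V_harm x; have := V_harm (x - 1); rewrite !meanV /V; lra.
have [Kx|nKx] := pselect (K (x - 1) x x).
  have := pfsumr_eq0 (fK _ _) (fun y _ => _) Kx0 Kx => /(_ _)/eqP.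
  rewrite subr_eq0 => /(_ _)/eqP; apply=> y.
  by rewrite subr_ge0.
have xx : x \in `](x - 1), x] by rewrite in_itv/= lexx andbT ltrBlDr ltrDl.
have ex0 : e x = 0.
  by apply: contrapT => /eqP/e_gt/ltW tx; apply: nKx; left.
rewrite -/(e x) ex0 -[RHS](mean_cst mu_prob); apply: eq_mean => g Sg.
by apply: contrapT => /eqP/e_gt/ltW tx; apply: nKx; right; exists g.
Qed.

End Excess.

Let f_ge0 x : 0 <= f x := jump_ge0 D_nd x.

(** Truncation at the height [t = f x]: the excess vanishes at [x], hence at every [g x]. If
    [f x = 0], which is not an admissible height, the harmonicity of [f] itself suffices. *)
Let jump_le g x : msupport mu g -> f (g x) <= f x.
Proof.
move=> Sg; have [f0|] := ltP 0 (f x).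
  have := excess_harmonic f0 x; rewrite subrr maxxx => fx0.
  have : Num.max (f (g x) - f x) 0 = 0.
    apply: (mean_eq0 mu_prob (F := fun g => Num.max (f (g x) - f x) 0)) => //.
      by move=> k _; rewrite le_max lexx orbT.
    by rewrite fx0.
  by move=> /eqP; rewrite eq_maxr subr_le0.
move=> fx0; have -> // : f (g x) = 0.
apply: (mean_eq0 mu_prob (F := fun g : homeo R => f (g x))) => //.
by rewrite mean_jump.
Qed.

Lemma jump_invariant g x : msupport mu g -> f (g x) = f x.
Proof.
move=> Sg; apply/eqP; rewrite eq_le jump_le//=.
rewrite -{1}(homeo_invK g x); apply: jump_le; exact: msupportV.
Qed.

End HarmonicJumps.

(** By the symmetry of [mu], the elements [h] such that both [h] and its inverse satisfy [P] form a
    subgroup containing the support. *)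
Lemma generated_group_ind (R : realType) (T : groupType) (mu : T -> R)
    (P : T -> Prop) : symmetric_measure mu ->
  (forall g, msupport mu g -> P g) -> P 1%g ->
  (forall g h, P g -> P h -> P (g * h)%g) ->
  forall g, generated_group (msupport mu) g -> P g.
Proof.
move=> mu_sym PS P1 PM g Gg.
suff [] : P g /\ P (g^-1)%g by [].
apply: (Gg [set h | P h /\ P (h^-1)%g]); split; last first.
  by move=> h Sh; split; apply: PS => //; exact: msupportV.
split; first by apply/mem_set; rewrite /= invg1.
move=> h k /set_mem[Ph PhV] /set_mem[Pk PkV]; apply/mem_set; split => /=.
  exact: PM.
by rewrite invgM invgK; exact: PM.
Qed.

Section ContinuousHarmonic.
Variables (R : realType) (mu : homeo R -> R).
Hypothesis mu_prob : finsupp_probability mu.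
Hypothesis mu_sym : symmetric_measure mu.
Hypothesis mu_irr : forall x, exists2 g, msupport mu g & g x != x.

(** If [D] were bounded on one side, rigidity would make it invariant. The level set of [D a] would
    then be unbounded above, contradicting [D a < D b]. *)
Lemma harmonic_unbounded (D : R -> R) :
  {homo D : x y / x <= y} -> (forall x, mean mu (fun g => D (g x)) = D x) ->
  (forall x, D y @[y --> x^'+] --> D x) -> (exists a b, D a < D b) ->
  (forall M, exists x, M < D x) /\ (forall M, exists x, D x < M).
Proof.
move=> D_nd D_harm D_rc [a [b Dab]].
have rlimE x : rlim D x = D x.
  exact: (norm_cvg_unique (@cvg_rlim _ _ D_nd x) (D_rc x)).
have nb : ~ (has_ubound (range D) \/ has_lbound (range D)).
  move=> Db; have D_inv g x : msupport mu g -> D (g x) = D x.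
    move=> Sg; rewrite -!rlimE; apply: (monotone_bounded mu_prob mu_sym) => //.
    by move=> u v _; rewrite !D_harm !subrr.
  have [||up _] := @invariant_set_unbounded R mu mu_sym mu_irr
      [set x | D x = D a].
  - by exists a.
  - by move=> g x Sg /= <-; exact: D_inv.
  - have [c Dc bc] := up b.
    by have := lt_le_trans Dab (D_nd _ _ (ltW bc)); rewrite Dc ltxx.
split=> M; apply: contrapT => nM; apply: nb; [left|right]; exists M => _ [x _ <-];
  by rewrite leNgt; apply/negP => ?; apply: nM; exists x.
Qed.

Hypothesis mu_nodisc : forall x,
  ~ discrete_orbit (orbit_of (generated_group (msupport mu)) x).

(** A positive jump at [x] is shared by its whole orbit, and a bounded interval holds only finitely
    many jumps of that size: the orbit would be discrete. *)
Lemma jump_eq0 (D : R -> R) :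
  {homo D : x y / x <= y} -> (forall x, mean mu (fun g => D (g x)) = D x) ->
  forall x, jump D x = 0.
Proof.
move=> D_nd D_harm x; apply: contrapT => jx.
have jx0 : 0 < jump D x by rewrite lt0r jump_ge0// andbT; exact/eqP.
apply: (mu_nodisc (x := x)); apply: locally_finite_discrete => a b.
apply: sub_finite_set (finite_big_jumps D_nd a b jx0) => y [[g Gg <-] xab].
split=> //; suff -> : jump D (g x) = jump D x by [].
apply: (generated_group_ind
  (P := fun h : homeo R => forall z, jump D (h z) = jump D z) mu_sym _ _ _ Gg).
- by move=> h Sh z; exact: (jump_invariant mu_prob mu_sym D_nd D_harm).
- by [].
- by move=> h k IHh IHk z; rewrite -(IHk z) -(IHh (k z)).
Qed.

Lemma exists_continuous_harmonic : exists D : R -> R,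
  [/\ {homo D : x y / x <= y}, forall x, mean mu (fun g => D (g x)) = D x,
      continuous D & forall y, exists x, D x = y].
Proof.
have [D [D_nd D_harm D_rc Dab]] :=
  exists_rcontinuous_harmonic mu_prob mu_sym mu_irr.
have Dc : continuous D.
  move=> x; apply/left_right_continuousP; split; last exact: D_rc.
  have /eqP := jump_eq0 D_nd D_harm x; rewrite subr_eq0 => /eqP ->.
  exact: cvg_llim.
have [up down] := harmonic_unbounded D_nd D_harm D_rc Dab.
exists D; split=> // y.
have [b yb] := up y; have [a ay] := down y.
have ab : a <= b.
  rewrite leNgt; apply/negP => /ltW/D_nd/(lt_le_trans yb)/(lt_trans ay).
  by rewrite ltxx.
have [||c _ Dcy] := @IVT R D a b y ab; last by exists c.
  exact: continuous_subspaceT.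
by rewrite (min_idPl (D_nd _ _ ab)) (max_idPr (D_nd _ _ ab)) (ltW ay) ltW.
Qed.

End ContinuousHarmonic.

(** * The induced action *)

Section GeneratedGroup.
Variables (T : groupType) (A : set T).
Let G := generated_group A.

Lemma sub_generated_group : A `<=` G.
Proof. by move=> g Ag M [_ AM]; exact: AM. Qed.

Lemma generated_group1 : G 1%g.
Proof. by move=> M [[/set_mem]]. Qed.

Lemma generated_groupV g : G g -> G (g^-1)%g.
Proof.
move=> Gg M MA; have [Mc _] := MA.
by apply/set_mem/(group_closedV Mc)/mem_set; exact: Gg.
Qed.

Lemma generated_groupM g h : G g -> G h -> G (g * h)%g.
Proof.
move=> Gg Gh M MA; have [Mc _] := MA.
by apply/set_mem/(group_closedM Mc); apply/mem_set; [exact: Gg|exact: Gh].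
Qed.

End GeneratedGroup.

(** * Push-forward of the measure *)

Section ImageMeasure.
Variables (R : realType) (T U : groupType) (mu : T -> R) (phi : T -> U).
Hypothesis mu_prob : finsupp_probability mu.
Hypothesis mu_sym : symmetric_measure mu.

Let S := msupport mu.
Let nu := image_measure phi mu.

Let fS : finite_set S. Proof. by case: mu_prob. Qed.

Let nuE k : nu k = \sum_(g \in S `&` phi @^-1` [set k]) mu g.
Proof.
rewrite /nu /image_measure; apply/esym/fsbig_widen => [g []//|g [gk nSg]].
by apply: contrapT => /= /eqP mug; apply: nSg.
Qed.

Lemma msupport_image : msupport nu = phi @` S.
Proof.
apply/seteqP; split=> [k /= nuk|_ [g Sg <-]].
  apply: contrapT => nk; move: nuk => /eqP; apply; rewrite nuE.
  by apply: fsbig1 => g [Sg gk]; case: nk; exists g.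
rewrite /msupport /= nuE gt_eqF// (fsbigD1 g)//=; last exact: finite_setIl.
rewrite ltr_pwDl ?msupport_gt0// fsumr_ge0// => h [[Sh _] _].
exact/ltW/msupport_gt0.
Qed.

Lemma image_measureE (F : U -> R) :
  \sum_(k \in msupport nu) nu k * F k = mean mu (F \o phi).
Proof.
rewrite msupport_image.
have -> : \sum_(k \in phi @` S) nu k * F k = \sum_(k \in phi @` S)
    \sum_(g \in S) (if g \in phi @^-1` [set k] then mu g * F (phi g) else 0).
  apply: eq_fsbigr => k _; rewrite nuE mulr_fsuml -fsbig_mkcondr.
  by apply: eq_fsbigr => g /set_mem[_ /= ->].
rewrite exchange_fsbig//; last exact: finite_image.
apply: eq_fsbigr => g /set_mem Sg.
rewrite (fsbigD1 (phi g))/=; [|exact: finite_image|by exists g].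
rewrite mem_set// fsbig1 ?addr0// => k [_ kg].
by rewrite memNset// => gk; apply: kg; rewrite -gk.
Qed.

Lemma image_prob : finsupp_probability nu.
Proof.
split.
- move=> k; rewrite nuE fsumr_ge0// => g [Sg _]; exact/ltW/msupport_gt0.
- by rewrite msupport_image; exact: finite_image.
- under eq_fsbigr do rewrite -[nu _]mulr1.
  by rewrite image_measureE mean_cst.
Qed.

Hypothesis phiV : forall g, S g -> phi g^-1%g = (phi g)^-1%g.

Lemma image_sym : symmetric_measure nu.
Proof.
move=> k; rewrite !nuE.
rewrite (@reindex_fsbig _ _ _ _ _ (fun g : T => g^-1%g)
  (S `&` phi @^-1` [set k]) (S `&` phi @^-1` [set k^-1%g])).
  by apply: eq_fsbigr => g _; exact: mu_sym.
split=> [g [Sg /= gk]|g h _ _|g [Sg /= gk]]; first 2 last.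
- exists g^-1%g; last exact: invgK.
  by split; [exact: msupportV|rewrite /= phiV// gk invgK].
- by split; [exact: msupportV|rewrite /= phiV// gk].
- exact: invg_inj.
Qed.

End ImageMeasure.

Lemma generated_group_image (R : realType) (T U : groupType) (mu : T -> R)
    (phi : T -> U) : symmetric_measure mu ->
  {in generated_group (msupport mu) &, {morph phi : g h / (g * h)%g}} ->
  generated_group (phi @` msupport mu) = phi @` generated_group (msupport mu).
Proof.
set G := generated_group (msupport mu) => mu_sym phiM.
have {}phiM g h : G g -> G h -> phi (g * h)%g = (phi g * phi h)%g.
  by move=> Gg Gh; apply: phiM; exact: mem_set.
have G1 : G 1%g := @generated_group1 _ _.
have phi1 : phi 1%g = 1%g.
  by apply: (mulgI (phi 1%g)); rewrite -phiM// !mulg1.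
have phiV g : G g -> phi (g^-1)%g = (phi g)^-1%g.
  move=> Gg; have GVg : G (g^-1)%g by exact: generated_groupV.
  by apply: (mulgI (phi g)); rewrite mulgV -phiM// mulgV.
apply/seteqP; split=> [k|_ [g Gg <-]].
  apply; split; last by move=> _ [g Sg <-]; exists g => //; exact: sub_generated_group.
  split; first by apply/mem_set; exists 1%g.
  move=> _ _ /set_mem[g Gg <-] /set_mem[h Gh <-]; apply/mem_set.
  exists (g * h^-1)%g; last by rewrite phiM ?phiV//; exact: generated_groupV.
  by apply: generated_groupM => //; exact: generated_groupV.
suff [] : G g /\ generated_group (phi @` msupport mu) (phi g) by [].
apply: (generated_group_ind
  (P := fun g => G g /\ generated_group (phi @` msupport mu) (phi g)) mu_sym _ _ _ Gg).
- move=> h Sh; split; first exact: sub_generated_group.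
  by apply: sub_generated_group; exists h.
- by rewrite phi1; split=> //; exact: generated_group1.
- move=> h k [Gh Ph] [Gk Pk]; split; first exact: generated_groupM.
  by rewrite phiM//; exact: generated_groupM.
Qed.

(** The preimages of [f x - e] and [f x + e] bracket [x]. *)
Lemma increasing_bij_continuous (R : realType) (f k : R -> R) :
  {homo f : x y / x < y} -> cancel k f -> continuous f.
Proof.
move=> f_inc kK x; apply/cvgrPdist_lt => e e0.
have f_le := ltW_homo f_inc.
have kx : k (f x - e) < x.
  by rewrite ltNge; apply/negP => /f_le; rewrite kK; lra.
have xk : x < k (f x + e).
  by rewrite ltNge; apply/negP => /f_le; rewrite kK; lra.
near=> y.
have /f_inc : k (f x - e) < y by near: y; exact: lt_nbhsr.
have /f_inc : y < k (f x + e) by near: y; exact: lt_nbhsl.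
by rewrite !kK ltr_distlC => -> ->.
Unshelve. all: by end_near. Qed.

(** * Descent of the action through [D] *)

Section SemiConjugacy.
Variables (R : realType) (G : set (homeo R)) (D : R -> R).
Hypothesis GV : forall g, G g -> G (g^-1)%g.
Hypothesis GM : forall g h, G g -> G h -> G (g * h)%g.
Hypothesis D_nd : {homo D : x y / x <= y}.
Hypothesis D_cont : continuous D.
Hypothesis D_surj : forall y, exists x, D x = y.
Hypothesis D_level : forall g x y, G g -> D x = D y -> D (g x) = D (g y).

Let sec y := projT1 (cid (D_surj y)).
Let secK y : D (sec y) = y. Proof. exact: projT2 (cid (D_surj y)). Qed.

(** [sec] is an arbitrary section of [D]; on [G], [D_level] makes the value independent of this
    choice. *)
Let bfun (g : homeo R) y := D (g (sec y)).

Let bfunE g x : G g -> bfun g (D x) = D (g x).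
Proof. by move=> Gg; apply: D_level; rewrite ?secK. Qed.

Let bfunK g : G g -> cancel (bfun g) (bfun (g^-1)%g).
Proof.
move=> Gg y; rewrite {2}/bfun bfunE; last exact: GV.
by rewrite homeo_invK secK.
Qed.

Let bfunVK g : G g -> cancel (bfun (g^-1)%g) (bfun g).
Proof.
move=> Gg y; rewrite {2}/bfun bfunE//.
by rewrite homeo_invVK secK.
Qed.

Let bfun_homo g : G g -> {homo bfun g : x y / x < y}.
Proof.
move=> Gg x y xy.
have sxy : sec x < sec y.
  by rewrite ltNge; apply/negP => /D_nd; rewrite !secK leNgt xy.
rewrite lt_neqAle D_nd ?andbT; last exact/homeo_homo_le/ltW.
by apply: contraTN xy => /eqP/(can_inj (bfunK Gg)) ->; rewrite ltxx.
Qed.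

Let bfun_homeo g : G g -> increasing_homeo (bfun g).
Proof.
move=> Gg; split; first exact: bfun_homo.
  exact: increasing_bij_continuous (bfun_homo Gg) (bfunVK Gg).
exists (bfun (g^-1)%g); last by split; [exact: bfunK|exact: bfunVK].
by apply: increasing_bij_continuous (bfunK Gg); exact/bfun_homo/GV.
Qed.

Lemma induced_action : exists bar : homeo R -> homeo R,
  (forall g x, G g -> bar g (D x) = D (g x)) /\
  semi_conjugate G (bar @` G) bar.
Proof.
(* The identity is a default value; for [g] in [G] the first branch is always taken. *)
pose bar g : homeo R := if pselect (increasing_homeo (bfun g)) is left H
  then Homeo (asboolT H) else 1%g.
have barE g x : G g -> bar g x = bfun g x.
  by move=> Gg; rewrite /bar; case: pselect => //; case; exact: bfun_homeo.
have barD g x : G g -> bar g (D x) = D (g x).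
  by move=> Gg; rewrite barE// bfunE.
exists bar; split=> //; split=> //; last by exists D; split=> // x g /barD ->.
move=> g h /set_mem Gg /set_mem Gh; apply: homeo_ext => x.
rewrite -(secK x) barD; last exact: GM.
by transitivity (bar g (bar h (D (sec x)))) => //; rewrite !barD.
Qed.

End SemiConjugacy.

Theorem proposition8p1 (R : realType) (mu : homeo R -> R) (G : set (homeo R))
    (mu_prob : finsupp_probability mu)
    (mu_sym : symmetric_measure mu)
    (mu_gen : generated_group (msupport mu) = G)
    (G_irr : irreducible_action G)
    (G_nodisc : forall x : R, ~ discrete_orbit (orbit_of G x)) :
  exists (Gbar : set (homeo R)) (bar : homeo R -> homeo R),
    semi_conjugate G Gbar bar /\ derriennic_pair Gbar (image_measure bar mu).
Proof.
have SG : msupport mu `<=` G by rewrite -mu_gen; exact: sub_generated_group.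
have mu_irr (x : R) : exists2 g, msupport mu g & g x != x.
  apply: contrapT => fix_x; apply: G_irr; exists x => g; rewrite -mu_gen.
  apply: (generated_group_ind (P := fun h : homeo R => h x = x)) => //.
    by move=> h Sh; apply: contrapT => /eqP hx; apply: fix_x; exists h.
  by move=> h k hx kx; transitivity (h (k x)) => //; rewrite kx.
have G_nodisc' x : ~ discrete_orbit (orbit_of (generated_group (msupport mu)) x).
  by rewrite mu_gen.
have [D [D_nd D_harm D_cont D_surj]] :=
  exists_continuous_harmonic mu_prob mu_sym mu_irr G_nodisc'.
(* The nonnegative increments [D (g y) - D (g x)] have mean [D y - D x = 0]. *)
have D_level_le g x y : msupport mu g -> x <= y -> D x = D y -> D (g x) = D (g y).
  move=> Sg xy Dxy; apply/esym/eqP; rewrite -subr_eq0; apply/eqP.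
  apply: (mean_eq0 mu_prob (F := fun g : homeo R => D (g y) - D (g x))) => //.
    by move=> h _; rewrite subr_ge0; exact/D_nd/homeo_homo_le.
  by rewrite meanB// !D_harm Dxy subrr.
have D_level g x y : G g -> D x = D y -> D (g x) = D (g y).
  rewrite -mu_gen => Gg; move: x y.
  apply: (generated_group_ind (P := fun h : homeo R =>
    forall x y, D x = D y -> D (h x) = D (h y)) mu_sym _ _ _ Gg) => //.
    move=> h Sh x y Dxy; have [xy|/ltW yx] := leP x y; first exact: D_level_le.
    exact/esym/D_level_le.
  by move=> h k hD kD x y Dxy; apply/hD/kD.
have GV g : G g -> G (g^-1)%g by rewrite -mu_gen; exact: generated_groupV.
have GM g h : G g -> G h -> G (g * h)%g.
  by rewrite -mu_gen; exact: generated_groupM.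
have [bar [barD bar_sc]] := induced_action GV GM D_nd D_cont D_surj D_level.
have [barM _ _] := bar_sc.
have barV g : msupport mu g -> bar (g^-1)%g = (bar g)^-1%g.
  move=> /SG Gg; apply: homeo_ext => y; have [x <-] := D_surj y.
  apply: (can_inj (homeo_invK (bar g))).
  by rewrite homeo_invVK !barD ?homeo_invVK//; exact: GV.
exists (bar @` G), bar; split=> //; split.
- exact: image_prob.
- exact: image_sym.
- rewrite msupport_image// -mu_gen; apply: generated_group_image => //.
  by rewrite mu_gen.
(* The fibre of [D] over a common fixed point [y] would be invariant, hence unbounded above,
   although [D] also takes the value [y + 1]. *)
- move=> [y fix_y]; have [x Dx] := D_surj y.
  have [||up _] := @invariant_set_unbounded R mu mu_sym mu_irr [set x | D x = y].
  + by exists x.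
  + move=> g z /SG Gg /= Dz; rewrite -barD// Dz; apply: fix_y.
    by exists g.
  + have [b Db] := D_surj (y + 1); have [a Da /ltW/D_nd] := up b.
    by rewrite Db Da; lra.
- move=> y; rewrite (image_measureE _ mu_prob (fun k : homeo R => k y)).
  have [x <-] := D_surj y; rewrite -[RHS]D_harm; apply: eq_mean => g /SG Gg.
  exact: barD.
Qed.
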